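(* Let $n\ge3$, let $\mathcal H_a^{\vec\epsilon}\neq 0$ be the space of Dunkl-harmonics of degree $a$ and parity $\vec\epsilon\in\{0,1\}^n$ (an irreducible space for $R(n)$), and let $N=\frac12\big(a-\sum_{j=1}^n\epsilon_j\big)$. Let $\{\psi_{\vec\ell}\}$ be a basis of $\mathcal H_a^{\vec\epsilon}$ diagonalized by the labelling Abelian algebra $\mathscr Y^\psi=\langle C_{[t]}\rangle_{2\le t\le n-1}$ and let $\{\varphi_{\vec k}\}$ be a basis diagonalized by $\mathscr Y^\varphi=\langle C_{[2\ldots t]}\rangle_{3\le t\le n}$, where $\vec\ell,\vec k$ range over the vectors in $\mathbb N^{n-2}$ (with $0\in\mathbb N$) with $|\vec\ell|_{n-2}\le N$, $|\vec k|_{n-2}\le N$, and the labelling is such that \[C_{[m]}\psi_{\vec\ell}=\kappa(|\vec\ell|_{m-1},\beta_{m-1})\psi_{\vec\ell}\ \ (2\le m\le n-1),\qquad C_{[2\ldots m+1]}\varphi_{\vec k}=\kappa(|\vec k|_{m-1},\beta_m-\beta_0-1)\varphi_{\vec k}\ \ (2\le m\le n-1).\] Then the connection coefficients $R_{\vec k}(\vec\ell)=\langle\varphi_{\vec k}|\psi_{\vec\ell}\rangle$ between these bases, i.e. the coefficients in $\psi_{\vec\ell}=\sum_{\vec k}R_{\vec k}(\vec\ell)\varphi_{\vec k}$, are, up to a gauge factor, equal to the multivariate Racah polynomials $R_{n-2}(\vec k;\vec x;\vec\beta;N)$ with $x_m=|\vec\ell|_m$ for $1\le m\le n-2$ and $x_{n-1}=N$.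 That is, there are nonzero scalars $g_{\vec\ell}$ and $h_{\vec k}$ (depending on the normalizations of the basis vectors) such that $R_{\vec k}(\vec\ell)=g_{\vec\ell}\,h_{\vec k}\,R_{n-2}(\vec k;\vec x;\vec\beta;N)$ for all $\vec k,\vec\ell$.
   Context: **Notation.** $[i\ldots j]=\{i,\dots,j\}$, $[m]=[1\ldots m]$, $|\vec k|_j=\sum_{i=1}^jk_i$, and $\kappa(x,\beta)=\left(x+\frac{\beta+1}{2}\right)\left(x+\frac{\beta-1}{2}\right)$. **Dunkl model.** Fix real $\mu_1,\dots,\mu_n>0$. On polynomials in $y_1,\dots,y_n$ let $r_j$ be the reflection $y_j\mapsto-y_j$ and $T_j=\partial_{y_j}+\frac{\mu_j}{y_j}(1-r_j)$. Let $\Delta=\sum_{j=1}^nT_j^2$. Let $\mathcal H_a$ be the space of homogeneous polynomials of degree $a$ in $\ker\Delta$, and for $\vec\epsilon\in\{0,1\}^n$ let $\mathcal H_a^{\vec\epsilon}=\{f\in\mathcal H_a: r_if=(-1)^{\epsilon_i}f\ \text{for all } i\}$. For nonempty $A\subset[n]$ put \[J_+^A=\tfrac12\sum_{j\in A}y_j^2,\quad J_-^A=\tfrac12\sum_{j\in A}T_j^2,\quad A_0^A=\tfrac12\sum_{j\in A}\big(y_j\partial_{y_j}+\tfrac12+\mu_j\big),\quad C_A=(A_0^A)^2-A_0^A-J_+^AJ_-^A .\] The operators $C_A$ preserve $\mathcal H_a^{\vec\epsilon}$; they generate the realization of the Racah algebra $R(n)$ in Dunkl operators. A basis is ''diagonalized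 by'' an algebra of operators if every basis vector is a joint eigenvector. **Parameters.** $\beta_{m-1}=\frac m2+\sum_{j=1}^m\mu_j-1+\sum_{j=1}^m\epsilon_j$ for $1\le m\le n$, and $\vec\beta=(\beta_0,\dots,\beta_{n-1})$. **Racah polynomials.** The univariate Racah polynomial is \[r_m(\alpha,\beta,\gamma,\delta;x)=(\alpha+1)_m(\beta+\delta+1)_m(\gamma+1)_m\;{}_4F_3\!\left[{-m,\ m+\alpha+\beta+1,\ -x,\ x+\gamma+\delta+1\atop \alpha+1,\ \beta+\delta+1,\ \gamma+1};1\right],\] understood as the polynomial expression (sum over $s=0,\dots,m$) obtained after cancelling denominators against the prefactors; $(c)_m$ is the Pochhammer symbol. The multivariate Racah polynomials are \[R_p(\vec k;\vec x;\vec\beta;N)=\prod_{j=1}^pr_{k_j}\big(2|\vec k|_{j-1}+\beta_j-\beta_0-1,\ \beta_{j+1}-\beta_j-1,\ |\vec k|_{j-1}-x_{j+1}-1,\ |\vec k|_{j-1}+\beta_j+x_{j+1};\ -|\vec k|_{j-1}+x_j\big),\] with $\vec x=(x_1,\dots,x_{n-2})$ and $x_{n-1}=N$. *)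

(* Defs.v *)
From HB Require Import structures.
From mathcomp Require Export all_boot all_order all_algebra.
From mathcomp.multinomials Require Export mpoly.

Set Implicit Arguments.
Unset Strict Implicit.
Unset Printing Implicit Defensive.

Import Order.TTheory GRing.Theory Num.Theory.
Local Open Scope ring_scope.

(* The scalars are an arbitrary numFieldType F, which covers both real and
   complex polynomials: in a numFieldType, 0 < mu j forces mu j to be real.

   Variables y_1, ..., y_n are 'X_i for i : 'I_n, i.e. numbered from 0;
   similarly the entries k_1, ..., k_p of k : 'X_{1..p} are k 0, ..., k p.-1. *)

(* [s...t] as a set of 1-based indices; y_j is in it iff s <= j <= t. *)
Definition seg (n s t : nat) : {set 'I_n} := [set i : 'I_n | (s <= i.+1 <= t)%N].

Arguments seg {n}.

Section Dunkl.
Variables (F : numFieldType) (n : nat).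
Implicit Types (f g : {mpoly F[n]}) (i j : 'I_n) (A : {set 'I_n}).

Definition refl i f : {mpoly F[n]} :=
  f \mPo [tuple (if j == i then - 'X_j else 'X_j) | j < n].

(* Quotient of f by y_i, the monomials not divisible by y_i being dropped;
   it is only applied to f - refl i f, where it is exact (see [mdivXP]). *)
Definition mdivX i f : {mpoly F[n]} :=
  \sum_(m <- msupp f | (0 < m i)%N) f@_m *: 'X_[m - U_(i)].

Definition dunkl (mu : 'I_n -> F) j f : {mpoly F[n]} :=
  f^`M(j) + mu j *: mdivX j (f - refl j f).

Definition dunkl_laplacian (mu : 'I_n -> F) f : {mpoly F[n]} :=
  \sum_(j < n) dunkl mu j (dunkl mu j f).

Definition dunkl_harmonic (mu : 'I_n -> F) (a : nat) (eps : 'I_n -> bool) f :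
    Prop :=
  [/\ f \is (a.-homog), dunkl_laplacian mu f = 0
    & forall i, refl i f = (-1) ^+ eps i *: f].

Definition Jplus A f : {mpoly F[n]} :=
  2^-1 *: \sum_(j in A) 'X_j ^+ 2 * f.

Definition Jminus (mu : 'I_n -> F) A f : {mpoly F[n]} :=
  2^-1 *: \sum_(j in A) dunkl mu j (dunkl mu j f).

Definition Azero (mu : 'I_n -> F) A f : {mpoly F[n]} :=
  2^-1 *: \sum_(j in A) ('X_j * f^`M(j) + (2^-1 + mu j) *: f).

Definition casimir (mu : 'I_n -> F) A f : {mpoly F[n]} :=
  Azero mu A (Azero mu A f) - Azero mu A f - Jplus A (Jminus mu A f).

(* For a >= |eps|, a - |eps| even, which always holds when there is a nonzero
   Dunkl harmonic of degree a and parity eps (see [dunkl_harmonic_deg]), this is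
   exactly (a - |eps|) / 2. *)
Definition racah_size (a : nat) (eps : 'I_n -> bool) : nat :=
  ((a - \sum_(j < n) eps j)./2)%N.

(* beta_i = (i + 1) / 2 + mu_1 + ... + mu_(i+1) - 1 + eps_1 + ... + eps_(i+1),
   meaningful for i <= n - 1. *)
Definition beta (mu : 'I_n -> F) (eps : 'I_n -> bool) (i : nat) : F :=
  i.+1%:R / 2 + \sum_(j < n | (j < i.+1)%N) mu j - 1
    + \sum_(j < n | (j < i.+1)%N) (eps j)%:R.

End Dunkl.

Section Bases.
Variables (F : numFieldType) (V : lmodType F).

Definition is_basis (I : finType) (H : V -> Prop) (b : I -> V) : Prop :=
  [/\ forall i, H (b i),
      forall c : I -> F, \sum_i c i *: b i = 0 -> forall i, c i = 0
    & forall v, H v -> exists c : I -> F, v = \sum_i c i *: b i].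

Inductive gen_alg (S : (V -> V) -> Prop) : (V -> V) -> Prop :=
| gen_alg_gen X of S X : gen_alg S X
| gen_alg_id : gen_alg S id
| gen_alg_scale (c : F) X of gen_alg S X : gen_alg S (fun v => c *: X v)
| gen_alg_add X Y of gen_alg S X & gen_alg S Y : gen_alg S (fun v => X v + Y v)
| gen_alg_comp X Y of gen_alg S X & gen_alg S Y : gen_alg S (X \o Y).

Definition diagonalized_by (I : finType) (Y : (V -> V) -> Prop) (b : I -> V) :
    Prop :=
  forall i X, Y X -> exists c : F, X (b i) = c *: b i.

End Bases.

(* |k|_j = k_1 + ... + k_j *)
Definition psum (p : nat) (k : 'X_{1..p}) (j : nat) : nat :=
  (\sum_(i < p | (i < j)%N) k i)%N.

Section Racah.
Variable F : numFieldType.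

Definition kappa (x b : F) : F := (x + (b + 1) / 2) * (x + (b - 1) / 2).

Definition poch (c : F) (m : nat) : F := \prod_(i < m) (c + i%:R).

(* The denominator Pochhammer symbols are cancelled against the prefactors by
   (c)_m / (c)_s = (c + s)_(m - s) for s <= m. *)
Definition racah (m : nat) (al be ga de x : F) : F :=
  \sum_(s < m.+1)
    poch (- m%:R) s * poch (m%:R + al + be + 1) s
      * poch (- x) s * poch (x + ga + de + 1) s / (s`!)%:R
      * (poch (al + 1 + s%:R) (m - s) * poch (be + de + 1 + s%:R) (m - s)
         * poch (ga + 1 + s%:R) (m - s)).

(* With j = i.+1: b i.+1 is beta_j, k i is k_j, nth N x i is x_j and
   nth N x i.+1 is x_(j+1), the default value implementing x_(p+1) = N. *)
Definition multi_racah (p : nat) (k : 'X_{1..p}) (x : p.-tuple F)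
    (b : nat -> F) (N : F) : F :=
  \prod_(i < p)
    racah (k i)
      (2 * (psum k i)%:R + b i.+1 - b 0%N - 1)
      (b i.+2 - b i.+1 - 1)
      ((psum k i)%:R - nth N x i.+1 - 1)
      ((psum k i)%:R + b i.+1 + nth N x i.+1)
      (- (psum k i)%:R + nth N x i).

End Racah.

Section Sanity.
Variables (F : numFieldType) (n : nat).
Implicit Types (f g : {mpoly F[n]}) (i j : 'I_n).

Lemma reflX i (m : 'X_{1..n}) :
  refl i ('X_[m] : {mpoly F[n]}) = (-1) ^+ m i *: 'X_[m].
Proof.
rewrite /refl comp_mpolyX (mpolyXE_id F m) (bigD1 i) //= [in RHS](bigD1 i) //=.
rewrite tnth_mktuple eqxx (exprNn ('X_i)) -mulrA -[RHS]mul_mpolyC rmorphXn /= rmorphN1.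
congr (_ * (_ * _)).
by apply: eq_bigr => j /negbTE ji; rewrite tnth_mktuple ji.
Qed.

Lemma mcoeff_refl i f (m : 'X_{1..n}) : (refl i f)@_m = (-1) ^+ m i * f@_m.
Proof.
rewrite /refl comp_mpolyEX [in RHS](mpolyE f) !raddf_sum mulr_sumr /=.
apply: eq_bigr => m' _; rewrite -/(refl i _) reflX !mcoeffZ mcoeffX mulrCA.
by case: eqP => [->|_]; rewrite ?mulr0.
Qed.

Lemma mdivXP j f : 'X_j * mdivX j (f - refl j f) = f - refl j f.
Proof.
set g := f - refl j f; rewrite [in RHS](mpolyE g) /mdivX mulr_sumr.
rewrite [RHS](bigID (fun m : 'X_{1..n} => (0 < m j)%N)) /= [X in _ + X]big1 ?addr0.
  apply: eq_bigr => m mj; rewrite -scalerAr -mpolyXD addmC submK //.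
  by apply/mnm_lepP => i; rewrite mnm1E; case: eqP => [<-|].
move=> m; rewrite lt0n negbK => /eqP mj.
by rewrite /g mcoeffB mcoeff_refl mj expr0 mul1r subrr scale0r.
Qed.

Lemma dunkl_harmonic_deg (mu : 'I_n -> F) (a : nat) (eps : 'I_n -> bool) f :
  dunkl_harmonic mu a eps f -> f != 0 ->
  a = (2 * racah_size a eps + \sum_(j < n) eps j)%N.
Proof.
case=> fh _ fe f0; set m := mlead f.
have mf : f@_m != 0 by rewrite mleadc_eq0.
have dm : mdeg m = a by apply: (dhomog_mf fh); rewrite mlead_supp.
have par i : odd (m i) = eps i.
  have /(congr1 (mcoeff m)) := fe i; rewrite mcoeff_refl mcoeffZ.
  by move=> /(mulIf mf); rewrite -signr_odd => /signr_inj.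
have E : a = (2 * (\sum_(j < n) (m j)./2) + \sum_(j < n) eps j)%N.
  rewrite -dm mdegE big_distrr -big_split /=; apply: eq_bigr => j _.
  by rewrite -[LHS]odd_double_half par addnC mul2n.
by rewrite /racah_size {2}E addnK !mul2n doubleK -mul2n.
Qed.

End Sanity.

(* Main.v *)
From HB Require Import structures.
Require Import Defs.
From mathcomp Require Import ring zify.

Import Order.TTheory GRing.Theory Num.Theory.
Local Open Scope ring_scope.

Set Implicit Arguments.
Unset Strict Implicit.
Unset Printing Implicit Defensive.

(** Each set A of variables carries a copy of sl(2): the raising operator is
    multiplication by E_A, the sum of the y_j^2 for j in A, the lowering operator
    is the sum of the T_j^2, and C_A is the Casimir element.  A harmonic
    polynomial is a lowest weight vector for the full set, and the copies
    attached to disjoint sets commute.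

    The joint spectrum of either labelling algebra is simple, because
    x |-> kappa x b is injective on the natural numbers for b > 0.  Hence every
    psi_l, and every phi_k, is determined up to a scalar by its eigenvalues
    ([eigenvector_unique]), and it is enough to expand explicit joint
    eigenvectors ([psi_vec]) in explicit joint eigenvectors ([phi_vec]).

    The explicit vectors come from coupling.  If f is a lowest weight vector of
    weights a and b for the disjoint sets A and B, then for each m there is,
    up to a scalar, one homogeneous polynomial [coupling] of degree m in E_A and
    E_B whose product with f is a lowest weight vector for the union of A and B.
    Starting from y^eps and adding the variables one by one, from y_1 for psi
    and from y_2 for phi (with y_1 coupled last), gives products of couplings.
    A Casimir C_A commutes with E_B when A is contained in B or disjoint from
    it, so C_[t] only sees the couplings made before the (t+1)st variable, and
    its eigenvalue is read off from a weight.

    Passing from one coupling scheme to the other takes n-2 recouplings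
    ((1 B) i) -> (1 (B i)) with B = [2..j+1] and i = j+2, each of which
    replaces the label x_j by |k|_j and leaves the other labels alone; this is
    why the answer is a product of univariate Racah polynomials.

    For one recoupling ([racah_recoupling]), both sides are lowest weight
    vectors, and such a vector is determined by its class modulo y_i^2
    ([lower_eq0]).  Modulo y_i^2 both coupling schemes become
    combinations of the same polynomials (E_1 + E_B)^(M-s) E_B^s.  The
    coefficients on the left are the factors (-l)_s (l + n1 + nb - 1)_s of the
    4F3; those on the right form a triangular matrix, whose inverse, computed by
    the telescoping sum [inverse_pair_sum], contributes the factors
    (-k)_s (k + nb + n3 - 1)_s.  Their product summed over s is the Racah
    polynomial.

    With [coupling] normalized by the coefficient 1 of E_A^m, the factor left in
    front of the Racah polynomial depends on |k|_(j-1) and k_j alone, so the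
    product of these factors over j is a gauge factor in k. *)

(** * Pochhammer symbols *)

Section Pochhammer.
Variable F : numFieldType.
Implicit Types (c s : F) (m k : nat).

Lemma poch0 c : poch c 0 = 1.
Proof. by rewrite /poch big_ord0. Qed.

Lemma pochSr c m : poch c m.+1 = poch c m * (c + m%:R).
Proof. by rewrite /poch big_ord_recr. Qed.

Lemma pochD c m k : poch c (m + k) = poch c m * poch (c + m%:R) k.
Proof.
elim: k => [|k IHk]; first by rewrite addn0 poch0 mulr1.
by rewrite addnS !pochSr IHk natrD addrA mulrA.
Qed.

Lemma pochS c m : poch c m.+1 = c * poch (c + 1) m.
Proof. by rewrite -add1n pochD pochSr poch0 mul1r addr0. Qed.

Lemma poch_gt0 c m : 0 < c -> 0 < poch c m.
Proof. by move=> c0; apply: prodr_gt0 => i _; rewrite ltr_wpDr. Qed.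

Lemma poch_neq0 c m : 0 < c -> poch c m != 0.
Proof. by move=> c0; rewrite lt0r_neq0 ?poch_gt0. Qed.

Lemma poch_eq0 m k : (k < m)%N -> poch (- k%:R) m = 0 :> F.
Proof. by move=> km; rewrite /poch (bigD1 (Ordinal km)) //= addNr mul0r. Qed.

Lemma fact_neq0 m : m`!%:R != 0 :> F.
Proof. by rewrite pnatr_eq0 -lt0n fact_gt0. Qed.

Lemma poch_natN m k : poch (- (m + k)%:R) m = (-1) ^+ m * (m + k)`!%:R / k`!%:R :> F.
Proof.
elim: m => [|m IHm]; first by rewrite poch0 expr0 mul1r divff ?fact_neq0.
have -> : (m.+1 + k)`! = ((m + k).+1 * (m + k)`!)%N by rewrite addSn factS.
rewrite pochS.
have -> : - (m.+1 + k)%:R + 1 = - (m + k)%:R :> F by rewrite addSn -natr1; ring.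
by rewrite IHm natrM addSn exprS; ring.
Qed.

(** The summand is (-1)^j C(n,j) (s + 2j - 1) / (n! (s + j - 1)_(n+1)), which is the
    difference of consecutive values of a hypergeometric term when n > 0;
    [part] below is the resulting closed form of the partial sums. *)
Lemma inverse_pair_sum s n : 1 < s ->
  \sum_(j < n.+1) (-1) ^+ j / (j`!%:R * (n - j)`!%:R * poch (s + j%:R - 1) j
                     * poch (s + 2 * j%:R) (n - j)) = (n == 0%N)%:R :> F.
Proof.
move=> s1; case: n => [|n].
  by rewrite big_ord1 !poch0 expr0 !mulr1 divr1.
have s0 : 0 < s := lt_trans ltr01 s1.
have part j k : n = (j + k)%N -> \sum_(i < j.+1) (-1) ^+ i /
     (i`!%:R * (n.+1 - i)`!%:R * poch (s + i%:R - 1) i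
         * poch (s + 2 * i%:R) (n.+1 - i))
     = (-1) ^+ j / (j`!%:R * k`!%:R * n.+1%:R * poch (s + j%:R) n.+1).
  elim: j k => [|j IHj] k nE.
    rewrite nE big_ord1 !poch0 subn0 fact0 factS natrM /=.
    by congr (_ / _); rewrite !mulr0 !addr0; ring.
  rewrite big_ord_recr /= (IHj k.+1) ?nE ?addSnnS //.
  have -> : ((j + k.+1).+1 - j.+1 = k.+1)%N by lia.
  have [c cE] : {c | c = s + 2 * j%:R + 2} by exists (s + 2 * j%:R + 2).
  have E1 : poch (s + j%:R) (j + k.+1).+1 = poch (s + j%:R) j.+1 *
      ((s + 2 * j%:R + 1) * poch c k).
    have e1 : s + j%:R + j.+1%:R = s + 2 * j%:R + 1 by rewrite -natr1; ring.
    have e2 : s + 2 * j%:R + 1 + 1 = c by rewrite cE; ring.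
    by rewrite -addSn pochD [poch _ k.+1]pochS e1 e2.
  have E2 : (s + j%:R) * poch (s + j.+1%:R) (j + k.+1).+1 = poch (s + j%:R) j.+1 *
      ((s + 2 * j%:R + 1) * poch c k) * (s + 2 * j%:R + 2 + k%:R).
    have -> : s + j.+1%:R = s + j%:R + 1 by rewrite -natr1; ring.
    rewrite -pochS pochSr E1; congr (_ * _); rewrite -natr1 natrD -natr1; ring.
  have ge0 (i : nat) : 0 <= i%:R :> F by apply: ler0n.
  have jN0 : s + j%:R != 0 by rewrite lt0r_neq0 ?ltr_wpDr.
  have A0 := poch_neq0 j.+1 (ltr_wpDr (ge0 j) s0).
  have c1 : s + 2 * j%:R + 1 != 0.
    by rewrite lt0r_neq0 // !ltr_wpDr ?mulr_ge0.
  have c2 : s + 2 * j%:R + 2 + k%:R != 0.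
    by rewrite lt0r_neq0 // !ltr_wpDr ?mulr_ge0.
  have B0 : poch c k != 0.
    by rewrite poch_neq0 // cE !ltr_wpDr ?mulr_ge0.
  have -> : poch (s + j.+1%:R) (j + k.+1).+1 = poch (s + j%:R) j.+1 *
      ((s + 2 * j%:R + 1) * poch c k)
        * (s + 2 * j%:R + 2 + k%:R) / (s + j%:R).
    by rewrite -E2 mulrAC divff ?mul1r.
  rewrite E1 (_ : s + j.+1%:R - 1 = s + j%:R); last by rewrite -natr1; ring.
  rewrite (_ : s + 2 * j.+1%:R = c); last by rewrite cE -natr1; ring.
  rewrite [poch c k.+1]pochSr [in c + _]cE exprS !factS !natrM.
  have f1 := fact_neq0 j; have f2 := fact_neq0 k.
  have n1 : j.+1%:R != 0 :> F by rewrite pnatr_eq0.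
  have n2 : k.+1%:R != 0 :> F by rewrite pnatr_eq0.
  have n3 : (j + k.+1).+1%:R != 0 :> F by rewrite pnatr_eq0.
  move: n1 n2 n3; rewrite -!natr1 natrD -!natr1 => n1 n2 n3.
  by field; rewrite f1 f2 n1 n2 n3 A0 B0 c1 c2 jN0.
rewrite big_ord_recr /= (part n 0%N) ?addn0 // subnn poch0.
rewrite (_ : s + n.+1%:R - 1 = s + n%:R); last by rewrite -natr1; ring.
have f1 := fact_neq0 n.
have n1 : n.+1%:R != 0 :> F by rewrite pnatr_eq0.
have A0 : poch (s + n%:R) n.+1 != 0 by rewrite poch_neq0 // ltr_wpDr.
move: n1; rewrite factS natrM exprS -natr1 => n1.
by field; rewrite f1 n1 A0 fact0 oner_neq0.
Qed.
End Pochhammer.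

(** * The sl(2) operators of a set of variables *)

HB.lock Definition dunkl_sq (F : numFieldType) n (mu : 'I_n -> F) j f :=
  dunkl mu j (dunkl mu j f).

(** The factor 2 in the weight of J_0 is cleared: summing over A gives 2 A_0^A. *)
HB.lock Definition euler (F : numFieldType) n (mu : 'I_n -> F) j (f : {mpoly F[n]}) :=
  'X_j * f^`M(j) + (2^-1 + mu j) *: f.

Section DunklOperators.
Variables (F : numFieldType) (n : nat) (mu : 'I_n -> F).
Implicit Types (f g : {mpoly F[n]}) (i j : 'I_n) (A B : {set 'I_n}) (m : 'X_{1..n}).

Definition dunkl_coef j (k : nat) : F := k%:R + mu j * (1 - (-1) ^+ k).

Lemma mcoeff_mdivX i f m : (mdivX i f)@_m = f@_(m + U_(i)).
Proof.
rewrite /mdivX [in RHS](mpolyE f) !raddf_sum big_mkcond /=.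
apply: eq_bigr => m' _; case: ifPn => [m'i|]; rewrite !(mcoeffZ, mcoeffX) ; last first.
  rewrite -eqn0Ngt => /eqP m'i.
  case: (m' =P (m + U_(i))%MM) => [m'E|_]; last by rewrite mulr0.
  by move: m'i; rewrite m'E mnmDE mnm1E eqxx addn1.
congr (_ * (nat_of_bool _)%:R).
apply/eqP/eqP => [<-|->]; last by rewrite addmK.
by rewrite submK //; apply/mnm_lepP => k; rewrite mnm1E; case: eqP => [<-|].
Qed.

Lemma mcoeff_dunkl j f m : (dunkl mu j f)@_m = dunkl_coef j (m j).+1 * f@_(m + U_(j)).
Proof.
rewrite /dunkl mcoeffD mcoeff_deriv mcoeffZ mcoeff_mdivX mcoeffB mcoeff_refl.
by rewrite mnmDE mnm1E eqxx addn1 /dunkl_coef -mulr_natr; ring.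
Qed.

Lemma mcoeff_dunkl_sq j f m : (dunkl_sq mu j f)@_m
  = dunkl_coef j (m j).+2 * dunkl_coef j (m j).+1 * f@_(m + U_(j) + U_(j)).
Proof.
rewrite dunkl_sq.unlock mcoeff_dunkl mcoeff_dunkl.
by rewrite mnmDE mnm1E eqxx addn1 mulrA [dunkl_coef j _ * _]mulrC.
Qed.

Fact dunkl_sq_is_linear j : linear (dunkl_sq mu j).
Proof.
move=> c f g; apply/mpolyP => m.
by rewrite mcoeff_dunkl_sq !mcoeffD !mcoeffZ !mcoeff_dunkl_sq mulrDr mulrCA.
Qed.
HB.instance Definition _ j := GRing.isLinear.Build F {mpoly F[n]} {mpoly F[n]} _
  (dunkl_sq mu j) (dunkl_sq_is_linear j).

Lemma mcoeff_sqrX i f m : ('X_i ^+ 2 * f)@_(m + U_(i) + U_(i)) = f@_m.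
Proof. by rewrite expr2 mulrC mulrA addmC mcoeffMX addmC mcoeffMX. Qed.

Lemma mcoeff_sqrX0 i f m : (m i < 2)%N -> ('X_i ^+ 2 * f)@_m = 0.
Proof.
move=> mi; rewrite (mpolyE f) mulr_sumr raddf_sum big1 //= => k _.
rewrite -scalerAr expr2 -mulrA -!mpolyXD mcoeffZ mcoeffX.
case: eqP => [kE|]; last by rewrite mulr0.
by move: mi; rewrite -kE !mnmDE mnm1E eqxx.
Qed.

Lemma mcoeff_euler j f m :
  (euler mu j f)@_m = ((m j)%:R + (2^-1 + mu j)) * f@_m.
Proof.
rewrite euler.unlock mcoeffD mcoeffZ [RHS]mulrDl; congr (_ + _).
rewrite (mpolyE f) !raddf_sum mulr_sumr mulr_sumr raddf_sum /=.
apply: eq_bigr => k _; rewrite linearZ /= mderivX -!scalerAr !mcoeffZ !mcoeffX.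
have [k0|k0] := posnP (k j).
  rewrite k0 !mul0r mulr0; case: eqP => [<-|]; last by rewrite !mulr0.
  by rewrite k0 mul0r.
rewrite -mpolyXD mcoeffX addmC submK.
  by case: eqP => [<-|]; rewrite ?mulr0 // !mulr1 mulrC.
by apply/mnm_lepP => l; rewrite mnm1E; case: eqP => [<-|].
Qed.

Lemma sqr_split i m : (2 <= m i)%N -> exists m', m = (m' + U_(i) + U_(i))%MM.
Proof.
move=> mi; exists (m - U_(i) - U_(i))%MM.
apply/mnmP => l; rewrite !(mnmDE, mnmBE, mnm1E).
by case: eqP => [<-|] //=; lia.
Qed.

Fact euler_is_linear j : linear (euler mu j).
Proof.
move=> c f g; apply/mpolyP => m.
by rewrite mcoeff_euler !mcoeffD !mcoeffZ !mcoeff_euler mulrDr mulrCA.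
Qed.
HB.instance Definition _ j :=
  GRing.isLinear.Build F {mpoly F[n]} {mpoly F[n]} _ (euler mu j) (euler_is_linear j).

Definition raise A : {mpoly F[n]} := \sum_(j in A) 'X_j ^+ 2.
Definition lower A f := \sum_(j in A) dunkl_sq mu j f.
Definition weight A f := \sum_(j in A) euler mu j f.

Fact lower_is_linear A : linear (lower A).
Proof.
move=> c f g; rewrite /lower scaler_sumr -big_split; apply: eq_bigr => j _ /=.
by rewrite !linearP.
Qed.
HB.instance Definition _ A :=
  GRing.isLinear.Build F {mpoly F[n]} {mpoly F[n]} _ (lower A) (lower_is_linear A).

Fact weight_is_linear A : linear (weight A).
Proof.
move=> c f g; rewrite /weight scaler_sumr -big_split; apply: eq_bigr => j _ /=.
by rewrite linearP.
Qed.
HB.instance Definition _ A :=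
  GRing.isLinear.Build F {mpoly F[n]} {mpoly F[n]} _ (weight A) (weight_is_linear A).

Lemma dunkl_coef_sqr j k : dunkl_coef j k.+2 * dunkl_coef j k.+1 =
  dunkl_coef j k * dunkl_coef j k.-1 + 4 * (k%:R + (2^-1 + mu j)).
Proof.
have sq k' : (-1) ^+ k' = (if odd k' then -1 else 1) :> F.
  by rewrite -signr_odd; case: odd.
rewrite /dunkl_coef !sq; case: k => [|k] /=; first by field.
by rewrite negbK; case: (odd k) => /=; rewrite -!natr1; field.
Qed.

Lemma dunkl_sq_sqrX i j f :
  dunkl_sq mu j ('X_i ^+ 2 * f) = 'X_i ^+ 2 * dunkl_sq mu j f
   + (j == i)%:R * 4 *: euler mu j f.
Proof.
apply/mpolyP => m; rewrite mcoeff_dunkl_sq mcoeffD mcoeffZ mcoeff_euler.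
have [->|ji] := eqVneq j i.
  rewrite mcoeff_sqrX dunkl_coef_sqr mul1r mulrDl mulrA; congr (_ + _).
  have [m2|/sqr_split [k ->]] := ltnP (m i) 2; last first.
    by rewrite mcoeff_sqrX mcoeff_dunkl_sq !mnmDE mnm1E eqxx !addn1.
  rewrite mcoeff_sqrX0 //; case: (m i) m2 => [|[]] //= _.
    by rewrite /dunkl_coef subrr mulr0 addr0 !mul0r.
  by rewrite /dunkl_coef subrr mulr0 addr0 mulr0 mul0r.
rewrite mul0r mul0r addr0.
have [m2|/sqr_split [k ->]] := ltnP (m i) 2.
  rewrite !mcoeff_sqrX0 ?mulr0 // !mnmDE mnm1E (negbTE ji) !addn0 //.
have -> : (k + U_(i) + U_(i) + U_(j) + U_(j)
           = k + U_(j) + U_(j) + U_(i) + U_(i))%MM.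
  by apply/mnmP => l; rewrite !mnmDE; lia.
by rewrite !mcoeff_sqrX mcoeff_dunkl_sq !mnmDE mnm1E eq_sym (negbTE ji) !addn0.
Qed.

(** [J_-, J_+] = 2 J_0 with the factors 1/2 cleared; it only sees the variables
    common to both sets, so that disjoint copies commute. *)
Lemma lower_raise A B f :
  lower A (raise B * f) = raise B * lower A f + 4 *: weight (A :&: B) f.
Proof.
rewrite /raise mulr_suml linear_sum mulr_suml /=.
have step i : lower A ('X_i ^+ 2 * f)
    = 'X_i ^+ 2 * lower A f + 4 *: \sum_(j in A | j == i) euler mu j f.
  rewrite /lower (eq_bigr _ (fun j _ => dunkl_sq_sqrX i j f)) big_split /= -mulr_sumr.
  congr (_ + _); rewrite scaler_sumr big_mkcondr; apply: eq_bigr => j _ /=.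
  by case: eqP => _; rewrite ?mul1r // mul0r scale0r.
rewrite (eq_bigr _ (fun i _ => step i)) big_split /= -scaler_sumr; congr (_ + _ *: _).
rewrite (exchange_big_dep (mem A)) /=; last by move=> i j _ /andP[].
rewrite /weight [RHS](eq_bigl (fun j => (j \in A) && (j \in B))); last by move=> j; rewrite inE.
rewrite [RHS]big_mkcondr; apply: eq_bigr => j jA; case: ifPn => jB.
  by rewrite (big_pred1 j) // => i /=; rewrite jA /= eq_sym andb_idl // => /eqP ->.
by rewrite big1 // => i /andP[iB /andP[_ /eqP ji]]; rewrite ji iB in jB.
Qed.

Lemma euler_sqrX i j f : euler mu j ('X_i ^+ 2 * f) =
  'X_i ^+ 2 * euler mu j f + (j == i)%:R * 2 *: ('X_i ^+ 2 * f).
Proof.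
apply/mpolyP => m; rewrite mcoeff_euler mcoeffD mcoeffZ.
have [m2|/sqr_split [k ->]] := ltnP (m i) 2.
  by rewrite !mcoeff_sqrX0 // !mulr0 addr0.
rewrite !mcoeff_sqrX mcoeff_euler !mnmDE mnm1E eq_sym -mulrDl.
by congr (_ * _); case: eqP => _ /=; rewrite ?addn0 ?natrD; ring.
Qed.

Lemma weight_raise A B f :
  weight A (raise B * f) = raise B * weight A f + 2 *: (raise (A :&: B) * f).
Proof.
rewrite /raise mulr_suml linear_sum !mulr_suml /=.
have step i : weight A ('X_i ^+ 2 * f)
    = 'X_i ^+ 2 * weight A f + (if i \in A then 2 else 0) *: ('X_i ^+ 2 * f).
  rewrite /weight (eq_bigr _ (fun j _ => euler_sqrX i j f)) big_split /= -mulr_sumr.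
  congr (_ + _); rewrite -scaler_suml; congr (_ *: _).
  case: ifPn => iA.
    rewrite (bigD1 i) //= eqxx mul1r big1 ?addr0 // => j /andP[_ /negbTE ->].
    by rewrite mul0r.
  rewrite big1 // => j jA; case: eqP => [ji|]; last by rewrite mul0r.
  by rewrite -ji jA in iA.
rewrite (eq_bigr _ (fun i _ => step i)) big_split /=; congr (_ + _).
rewrite scaler_sumr [RHS](eq_bigl (fun i => (i \in B) && (i \in A))); last first.
  by move=> i; rewrite inE andbC.
by rewrite [RHS]big_mkcondr; apply: eq_bigr => i _; case: ifP => // _; rewrite scale0r.
Qed.

Lemma raiseU A B : [disjoint A & B] -> raise (A :|: B) = raise A + raise B.
Proof. by move=> dAB; rewrite /raise -bigU //; apply: eq_bigl => i; rewrite !inE. Qed.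

Lemma lowerU A B f : [disjoint A & B] -> lower (A :|: B) f = lower A f + lower B f.
Proof. by move=> dAB; rewrite /lower -bigU //; apply: eq_bigl => i; rewrite !inE. Qed.

Lemma weightU A B f : [disjoint A & B] -> weight (A :|: B) f = weight A f + weight B f.
Proof. by move=> dAB; rewrite /weight -bigU //; apply: eq_bigl => i; rewrite !inE. Qed.

Lemma raise0 : raise set0 = 0.
Proof. by rewrite /raise big_set0. Qed.

Lemma weight0 f : weight set0 f = 0.
Proof. by rewrite /weight big_set0. Qed.

Lemma casimirE A f : casimir mu A f =
  4^-1 *: (weight A (weight A f) - 2 *: weight A f - raise A * lower A f).
Proof.
have AE g : Azero mu A g = 2^-1 *: weight A g.
  by congr (_ *: _); apply: eq_bigr => j _; rewrite euler.unlock.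
have JE : \sum_(j in A) dunkl mu j (dunkl mu j f) = lower A f.
  by apply: eq_bigr => j _; rewrite dunkl_sq.unlock.
rewrite /casimir !AE linearZ /= /Jplus -mulr_suml -/(raise A) /Jminus JE.
rewrite -scalerAr !scalerBr !scalerA.
by congr (_ *: _ - _ *: _ - _ *: _); field.
Qed.

Fact casimir_is_linear A : linear (casimir mu A).
Proof.
move=> c f g; rewrite !casimirE !linearP /= mulrDr -scalerAr.
move: (weight A (weight A f)) (weight A (weight A g)) (weight A f) (weight A g) => p p' q q'.
move: (raise A * _) (raise A * _) => r r'.
by rewrite -!mul_mpolyC; ring.
Qed.
HB.instance Definition _ A := GRing.isLinear.Build F {mpoly F[n]} {mpoly F[n]} _
  (casimir mu A) (casimir_is_linear A).

Lemma casimir_raise_disjoint A B f : [disjoint A & B] ->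
  casimir mu A (raise B * f) = raise B * casimir mu A f.
Proof.
move=> dAB; have AB0 : A :&: B = set0 by apply/eqP; rewrite setI_eq0.
rewrite !casimirE !(lower_raise, weight_raise) AB0 weight0 raise0 !mul0r.
by rewrite !scaler0 !addr0 weight_raise AB0 raise0 mul0r scaler0 addr0; rewrite -!mul_mpolyC; ring.
Qed.

Lemma casimir_raise_id A f : casimir mu A (raise A * f) = raise A * casimir mu A f.
Proof.
have W g : weight A (raise A * g) = raise A * weight A g + 2 *: (raise A * g).
  by rewrite weight_raise setIid.
rewrite !casimirE W [weight A (_ + _)]linearD /= [weight A (2 *: _)]linearZ /= !W lower_raise setIid.
move: (weight A (weight A f)) (weight A f) (lower A f) (raise A) => p q r X.
have E4 : 4%:MP = 4 :> {mpoly F[n]} by rewrite -mpolyC_nat.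
have E2 : 2%:MP = 2 :> {mpoly F[n]} by rewrite -mpolyC_nat.
by rewrite -!mul_mpolyC E4 E2; ring.
Qed.

(** E_B is E_A plus an element that lives outside A, and C_A is central in its
    own copy of sl(2). *)
Lemma casimir_raise_sub A B f : A \subset B ->
  casimir mu A (raise B * f) = raise B * casimir mu A f.
Proof.
move=> sAB; have dA : [disjoint A & B :\: A].
  by rewrite disjoint_sym disjoints_subset setDE subsetIr.
have -> : raise B = raise A + raise (B :\: A).
  by rewrite -raiseU // -[in LHS](setID B A) (setIidPr sAB).
rewrite !mulrDl [casimir mu A (_ + _)]linearD /= casimir_raise_id.
by rewrite casimir_raise_disjoint.
Qed.

Lemma dunkl_coef_neq0 j k : 0 < mu j -> dunkl_coef j k.+1 != 0.
Proof.
move=> mu0; rewrite /dunkl_coef lt0r_neq0 // ltr_wpDr ?ltr0Sn //.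
rewrite mulr_ge0 ?(ltW mu0) // -signr_odd subr_ge0.
by case: odd; rewrite ?expr0 // expr1 (le_trans (lerN10 _)) ?ler01.
Qed.

(** T_i^2 sends y_i^c to a nonzero multiple of y_i^(c-2) for c >= 2, hence the
    equation lower A f = 0 expresses the part of f of degree c in y_i through the
    parts of lower degree in y_i. *)
Lemma lower_eq0 A i f g : 0 < mu i -> i \in A -> lower A f = 0 -> f = 'X_i ^+ 2 * g -> f = 0.
Proof.
move=> mu0 iA Lf fE.
suff H c m : (m i < c)%N -> f@_m = 0 by apply/mpolyP => m; rewrite mcoeff0 (H (m i).+1).
elim: c m => // c IHc m mc.
have [m2|/sqr_split [k mE]] := ltnP (m i) 2; first by rewrite fE mcoeff_sqrX0.
have /(congr1 (mcoeff k)) := Lf; rewrite mcoeff0 /lower raddf_sum (bigD1 i) //=.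
rewrite big1 => [|j /andP[_ ji]]; last first.
  rewrite mcoeff_dunkl_sq IHc ?mulr0 // -ltnS (leq_trans _ mc) // mE.
  by rewrite !mnmDE !mnm1E (negbTE ji) eqxx !addn0 !addn1 ltnS.
rewrite addr0 mcoeff_dunkl_sq -mE => /eqP.
by rewrite !mulf_eq0 !(negbTE (dunkl_coef_neq0 _ _)) //= => /eqP.
Qed.

Definition lowest A (a : F) f := lower A f = 0 /\ weight A f = a *: f.

Lemma lowest_raise A B a f : [disjoint A & B] ->
  lowest A a f -> lowest A a (raise B * f).
Proof.
move=> dAB [LA WA]; have AB0 : A :&: B = set0 by apply/eqP; rewrite setI_eq0.
split; first by rewrite lower_raise LA mulr0 AB0 weight0 scaler0 addr0.
by rewrite weight_raise WA AB0 raise0 mul0r scaler0 addr0 scalerAr.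
Qed.

Lemma lowest_raise_exp A B a f p : [disjoint A & B] ->
  lowest A a f -> lowest A a (raise B ^+ p * f).
Proof.
move=> dAB lf; elim: p => [|p IHp]; first by rewrite mul1r.
by rewrite exprS -mulrA; apply: lowest_raise.
Qed.

Lemma casimir_lowest A a f :
  lowest A a f -> casimir mu A f = (a / 2) * (a / 2 - 1) *: f.
Proof.
move=> [LA WA]; rewrite casimirE LA WA linearZ /= WA mulr0 subr0 !scalerA -scalerBl scalerA.
by congr (_ *: _); field.
Qed.

Lemma weight_raise_exp A w f p : weight A f = w *: f ->
  weight A (raise A ^+ p * f) = (w + 2 * p%:R) *: (raise A ^+ p * f).
Proof.
move=> wf; elim: p => [|p IHp]; first by rewrite mul1r mulr0 addr0.
rewrite exprS -mulrA weight_raise setIid IHp -scalerAr -scalerDl.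
by congr (_ *: _); rewrite -natr1; ring.
Qed.

Lemma lower_raise_exp A w f p : weight A f = w *: f ->
  lower A (raise A ^+ p * f) = raise A ^+ p * lower A f
    + (4 * p%:R * (w + p%:R - 1)) *: (raise A ^+ p.-1 * f).
Proof.
move=> wf; elim: p => [|p IHp]; first by rewrite !mul1r mulr0 mul0r scale0r addr0.
rewrite exprS -mulrA lower_raise setIid IHp (weight_raise_exp _ wf) mulrDr mulrA -exprS -addrA.
congr (_ + _); case: p {IHp} => [|p] /=.
  by rewrite !(mulr0, mul0r, scale0r, add0r, scalerA, mul1r); congr (_ *: _); ring.
rewrite -scalerAr mulrA -exprS scalerA -scalerDl; congr (_ *: _).
by rewrite -!natr1; ring.
Qed.

End DunklOperators.

(** * Coupling of two lowest weight vectors *)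

Section Coupling.
Variables (F : numFieldType) (n : nat).
Implicit Types (a b c : F) (X Y Z p q f : {mpoly F[n]}).

Definition coupling_coef (m : nat) a b (s : nat) : F :=
  poch (- m%:R) s * poch (m%:R + a + b - 1) s / (s`!%:R * poch b s).

(** A Jacobi polynomial in Y / (X + Y), homogenized.  Expanding along powers of
    X + Y, on which the diagonal sl(2) acts directly, makes the lowest weight
    property a telescoping sum ([lowest_coupling]) and reduces modulo a third
    variable to the same monomials in both coupling schemes. *)
Definition coupling (m : nat) a b X Y : {mpoly F[n]} :=
  \sum_(s < m.+1) coupling_coef m a b s *: ((X + Y) ^+ (m - s) * Y ^+ s).

Lemma coupling_coef0 m a b : coupling_coef m a b 0 = 1.
Proof. by rewrite /coupling_coef !poch0 fact0 !mul1r invr1. Qed.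

(** Only the term s = 0 survives: the coupling is normalized by the coefficient 1
    of X^m, and modulo Y it is X^m. *)
Lemma coupling0 m a b X : coupling m a b X 0 = X ^+ m.
Proof.
rewrite /coupling big_ord_recl coupling_coef0 scale1r subn0 addr0 mulr1 big1 ?addr0 // => s _.
by rewrite expr0n mulr0 scaler0.
Qed.

Lemma coupling_comm (P : {linear {mpoly F[n]} -> {mpoly F[n]}}) m a b X Y f :
  (forall g, P (X * g) = X * P g) -> (forall g, P (Y * g) = Y * P g) ->
  P (coupling m a b X Y * f) = coupling m a b X Y * P f.
Proof.
move=> PX PY; rewrite /coupling !mulr_suml linear_sum; apply: eq_bigr => s _ /=.
have PXn Z k g : (forall g, P (Z * g) = Z * P g) -> P (Z ^+ k * g) = Z ^+ k * P g.
  move=> PZ; elim: k g => [|k IHk] g; first by rewrite !mul1r.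
  by rewrite exprS -!mulrA PZ IHk.
have PXY g : P ((X + Y) * g) = (X + Y) * P g.
  by rewrite !mulrDl linearD /= PX PY.
by rewrite -!scalerAl linearZ /= -!mulrA (PXn (X + Y)) // (PXn Y).
Qed.

Lemma meval_coupling m a b X Y (v : 'I_n -> F) :
  X.@[v] = 1 -> Y.@[v] = 0 -> (coupling m a b X Y).@[v] = 1.
Proof.
move=> X1 Y0; rewrite /coupling raddf_sum big_ord_recl /= coupling_coef0 scale1r subn0.
rewrite mevalM !rmorphXn /= mevalD X1 Y0 addr0 expr1n expr0 mulr1 big1 ?addr0 // => s _.
by rewrite mevalZ mevalM !rmorphXn /= Y0 expr0n mulr0 mulr0.
Qed.

(** Congruence modulo the ideal of Z; it will be used with Z = y_i^2. *)
Definition congmod Z p q := exists g, p - q = Z * g.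

Lemma congmod_refl Z p : congmod Z p p.
Proof. by exists 0; rewrite subrr mulr0. Qed.

Lemma congmodD Z p q p' q' :
  congmod Z p q -> congmod Z p' q' -> congmod Z (p + p') (q + q').
Proof. by move=> [g gE] [h hE]; exists (g + h); rewrite mulrDr -gE -hE; ring. Qed.

Lemma congmodM Z p q p' q' :
  congmod Z p q -> congmod Z p' q' -> congmod Z (p * p') (q * q').
Proof.
move=> [g gE] [h hE]; exists (g * p' + q * h).
by rewrite mulrDr mulrA -gE mulrCA -hE; ring.
Qed.

Lemma congmodX Z p q k : congmod Z p q -> congmod Z (p ^+ k) (q ^+ k).
Proof.
move=> pq; elim: k => [|k IHk]; first exact: congmod_refl.
by rewrite !exprS; apply: congmodM.
Qed.

Lemma congmod_sum Z (I : finType) (c : I -> F) (p q : I -> {mpoly F[n]}) :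
  (forall i, congmod Z (p i) (q i)) ->
  congmod Z (\sum_i c i *: p i) (\sum_i c i *: q i).
Proof.
move=> pq; elim/big_rec2: _ => [|i p' q' _ pq']; first exact: congmod_refl.
apply: congmodD => //; have [g gE] := pq i; exists (c i *: g).
by rewrite -scalerBr gE scalerAr.
Qed.

Lemma congmod_coupling Z m a b X Y X' Y' : congmod Z X X' -> congmod Z Y Y' ->
  congmod Z (coupling m a b X Y) (coupling m a b X' Y').
Proof.
move=> XX YY; apply: congmod_sum => s.
by apply: congmodM; apply: congmodX => //; apply: congmodD.
Qed.

End Coupling.

(** * Recoupling three commuting copies of sl(2) *)

Lemma sum_ord_shift (V : nmodType) (G : nat -> V) (k m : nat) : (k <= m)%N ->
  \sum_(t < (m - k).+1) G (k + t)%N = \sum_(r < m.+1 | (k <= r)%N) G r.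
Proof.
move=> km; rewrite -(big_geq_mkord k m.+1 xpredT G) (big_addn 0 _ k) subSn //.
by rewrite big_mkord; apply: eq_bigr => t _; rewrite addnC.
Qed.

Lemma sum_ord_widen0 (V : nmodType) (G : nat -> V) (k m : nat) : (k <= m)%N ->
  (forall r, (k < r)%N -> G r = 0) -> \sum_(r < k.+1) G r = \sum_(r < m.+1) G r.
Proof.
move=> km G0; rewrite (big_ord_widen m.+1) // big_mkcond; apply: eq_bigr => r _.
by rewrite ltnS; case: leqP => // /G0.
Qed.

Section Recoupling.
Variables (F : numFieldType) (n : nat).
Implicit Types (X Y Z : {mpoly F[n]}).

Variables (n1 nb n3 : F) (M : nat).
Let sg := nb + n3.
Let T := n1 + nb + n3 - 1 + M%:R.

(** Coordinate of (X + Y)^(M-s) Y^s on coupling (M - k) X Y * Y^k.  These products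
    are triangular in the vectors (X + Y)^(M-r) Y^r, and the inverse of that
    triangular matrix is again given by Pochhammer symbols. *)
Definition recoupling_coef (k s : nat) : F :=
  (-1) ^+ k / (k`!%:R * poch (sg + k%:R - 1) k)
   * (poch (- k%:R) s * poch (k%:R + sg - 1) s
       * poch (T + s%:R) (k - s) * poch (- M%:R + s%:R) (k - s)).

(** The Pochhammer symbols in M combine into factors that do not depend on j, and
    what is left is [inverse_pair_sum] with s replaced by sg + 2 s. *)
Lemma recoupling_inverse s r : 1 < sg -> (s + r <= M)%N ->
  \sum_(j < r.+1) recoupling_coef (s + j) s
     * coupling_coef (M - (s + j)) n1 (sg + 2 * (s + j)%:R) (r - j) = (r == 0%N)%:R.
Proof.
move=> sg1 srM.
transitivity (poch (T + s%:R) r * poch (- M%:R + s%:R) r * (r == 0%N)%:R); last first.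
  by case: eqP => [->|]; rewrite ?mulr0 // !poch0 !mulr1.
have sg2 : 1 < sg + 2 * s%:R by rewrite ltr_wpDr ?mulr_ge0.
rewrite -(inverse_pair_sum r sg2) mulr_sumr; apply: eq_bigr => j _.
have [jr] : exists i, r = (j + i)%N by exists (r - j)%N; have := ltn_ord j; lia.
move: (nat_of_ord j) => {}j rE; rewrite /recoupling_coef /coupling_coef.
have -> : (r - j = jr)%N by lia.
have -> : (s + j - s = j)%N by lia.
have -> : - (M - (s + j))%:R = - M%:R + s%:R + j%:R :> F.
  by rewrite natrB ?natrD; [ring | lia].
have -> : (M - (s + j))%:R + n1 + (sg + 2 * (s + j)%:R) - 1 = T + s%:R + j%:R.
  by rewrite natrB ?natrD /T /sg; [ring | lia].
rewrite rE !pochD poch_natN exprD.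
have -> : sg + (s + j)%:R - 1 = sg + s%:R + j%:R - 1 by rewrite natrD; ring.
have -> : (s + j)%:R + sg - 1 = sg + s%:R + j%:R - 1 by rewrite natrD; ring.
have -> : sg + s%:R + j%:R - 1 + s%:R = sg + 2 * s%:R + j%:R - 1 by ring.
have -> : sg + 2 * (s + j)%:R = sg + 2 * s%:R + 2 * j%:R by rewrite natrD; ring.
have ge0 (i : nat) : 0 <= i%:R :> F by apply: ler0n.
have sg0 : 0 < sg - 1 by rewrite subr_gt0.
have sgp : 0 < sg := lt_trans ltr01 sg1.
have h1 : poch (sg + s%:R + j%:R - 1) s != 0.
  rewrite poch_neq0 // (_ : _ - 1 = sg - 1 + s%:R + j%:R); last by ring.
  by rewrite 2?ltr_wpDr.
have h2 : poch (sg + 2 * s%:R + j%:R - 1) j != 0.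
  rewrite poch_neq0 // (_ : _ - 1 = sg - 1 + 2 * s%:R + j%:R); last by ring.
  by rewrite 2?ltr_wpDr ?mulr_ge0.
have h3 : poch (sg + 2 * s%:R + 2 * j%:R) jr != 0.
  by rewrite poch_neq0 // 2?ltr_wpDr ?mulr_ge0.
have f1 := fact_neq0 F j; have f2 := fact_neq0 F jr; have f3 := fact_neq0 F (s + j).
have s2 : (-1) ^+ s * (-1) ^+ s = 1 :> F by rewrite -exprD addnn -mul2n exprM sqrrN expr1n expr1n.
move: h1 h2 h3; move: (poch _ s) (poch (_ - 1) j) (poch (_ + 2 * j%:R) jr).
move=> P1 P2 P3 h1 h2 h3.
move: (poch (T + s%:R) j) (poch _ jr) (poch (- M%:R + s%:R) j) (poch _ jr).
move=> Q1 Q2 Q3 Q4.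
transitivity (((-1) ^+ s * (-1) ^+ s) * ((-1) ^+ j / (j`!%:R * jr`!%:R * P2 * P3))
               * (Q1 * Q2 * (Q3 * Q4))).
  by field; rewrite h1 h2 h3 f1 f2 f3.
by rewrite s2 mul1r mulrC.
Qed.

Definition recoupling_gauge (k : nat) : F :=
  (-1) ^+ k / (k`!%:R * poch nb k * poch (sg + k%:R - 1) k).

Variable l : nat.

(** The polynomial r_k for the recoupling of lowest weights n1, nb, n3 (each
    twice the J_0 eigenvalue) at total level M: alpha + 1 = nb, beta + 1 = n3 and
    gamma + 1 = -M. *)
Definition recoupling_racah (k : nat) : F :=
  racah k (nb - 1) (n3 - 1) (- M%:R - 1) (n1 + nb - 1 + M%:R) l%:R.

Lemma recoupling_racahE k : 0 < nb -> 1 < sg -> recoupling_gauge k * recoupling_racah k =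
  \sum_(s < k.+1) coupling_coef l n1 nb s * recoupling_coef k s.
Proof.
move=> nb0 sg1; rewrite /recoupling_racah /racah mulr_sumr; apply: eq_bigr => s _.
have [k'] : exists i, k = (s + i)%N by exists (k - s)%N; have := ltn_ord s; lia.
move: (nat_of_ord s) => {}s ->; rewrite /recoupling_gauge /recoupling_coef /coupling_coef.
have -> : (s + k' - s = k')%N by lia.
have -> : (s + k')%:R + (nb - 1) + (n3 - 1) + 1 = (s + k')%:R + sg - 1.
  by rewrite /sg; ring.
have -> : l%:R + (- M%:R - 1) + (n1 + nb - 1 + M%:R) + 1 = l%:R + n1 + nb - 1 by ring.
have -> : nb - 1 + 1 + s%:R = nb + s%:R by ring.
have -> : n3 - 1 + (n1 + nb - 1 + M%:R) + 1 + s%:R = T + s%:R by rewrite /T; ring.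
have -> : - M%:R - 1 + 1 + s%:R = - M%:R + s%:R :> F by ring.
rewrite [poch nb (s + k')]pochD.
have f1 := fact_neq0 F s; have p1 := poch_neq0 s nb0.
have p2 : poch (nb + s%:R) k' != 0 by rewrite poch_neq0 // ltr_wpDr.
have p3 : poch (sg + (s + k')%:R - 1) (s + k') != 0.
  by rewrite poch_neq0 // addrAC ltr_wpDr // subr_gt0.
have f2 := fact_neq0 F (s + k').
move: (poch nb s) (poch (nb + s%:R) k') (poch _ (s + k')) p1 p2 p3 => P1 P2 P3 p1 p2 p3.
move: (poch _ s) (poch _ s) (poch _ s) (poch _ s) => Q1 Q2 Q3 Q4.
move: (poch _ k') (poch _ k') => Q5 Q6.
by field; rewrite f1 f2 p1 p2 p3.
Qed.

Lemma coupling_coef_eq0 m a b s : (m < s)%N -> coupling_coef m a b s = 0 :> F.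
Proof. by move=> ms; rewrite /coupling_coef poch_eq0 // !mul0r. Qed.

(** Recoupling modulo the third variable: (X + Y)^(M-l) times the coupling of
    level l is expanded on v s = (X + Y)^(M-s) Y^s, and each v s is expanded
    through [recoupling_inverse]. *)
Lemma recoupling_slice X Y : 0 < nb -> 1 < sg -> (l <= M)%N ->
  (X + Y) ^+ (M - l) * coupling l n1 nb X Y = \sum_(k < M.+1)
    (recoupling_gauge k * recoupling_racah k) *: (coupling (M - k) n1 (sg + 2 * k%:R) X Y * Y ^+ k).
Proof.
move=> nb0 sg1 lM; pose v s := (X + Y) ^+ (M - s) * Y ^+ s.
transitivity (\sum_(s < M.+1) coupling_coef l n1 nb s *: v s).
  rewrite -(sum_ord_widen0 (G := fun s => coupling_coef l n1 nb s *: v s) lM); last first.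
    by move=> s ls; rewrite coupling_coef_eq0 ?scale0r.
  rewrite mulr_sumr; apply: eq_bigr => s _; rewrite -scalerAr mulrA -exprD.
  by congr (_ *: (_ ^+ _ * _)); have := ltn_ord s; lia.
have inner k : (k < M.+1)%N -> coupling (M - k) n1 (sg + 2 * k%:R) X Y * Y ^+ k
    = \sum_(r < M.+1 | (k <= r)%N)
        coupling_coef (M - k) n1 (sg + 2 * k%:R) (r - k) *: v r.
  rewrite ltnS => kM.
  rewrite -(sum_ord_shift (fun r => coupling_coef (M - k) n1 (sg + 2 * k%:R) (r - k) *: v r) kM).
  rewrite mulr_suml; apply: eq_bigr => t _.
  by rewrite -scalerAl -mulrA -exprD addKn /v subnDA (addnC _ k).
have core (s r : 'I_M.+1) : (s <= r)%N ->
   \sum_(k < M.+1 | (s <= k)%N && (k <= r)%N) recoupling_coef k s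
     * coupling_coef (M - k) n1 (sg + 2 * k%:R) (r - k) = (r == s)%:R.
  move=> sr; have rM : (r < M.+1)%N := ltn_ord r.
  rewrite -(big_ord_widen_cond M.+1 (fun k => (s <= k)%N) (fun k => recoupling_coef k s
     * coupling_coef (M - k) n1 (sg + 2 * k%:R) (r - k)) rM).
  rewrite -(sum_ord_shift (fun k => recoupling_coef k s
     * coupling_coef (M - k) n1 (sg + 2 * k%:R) (r - k)) sr).
  have := @recoupling_inverse s (r - s) sg1; rewrite subnKC // => /(_ (ltn_ord r)) E.
  rewrite (_ : (r == s) = (r - s == 0)%N) -?E; last first.
    by rewrite subn_eq0 -val_eqE /= eqn_leq sr andbT.
  by apply: eq_bigr => j _; rewrite [(r - (s + j))%N]subnDA.
transitivity (\sum_(k < M.+1) \sum_(s < M.+1 | (s <= k)%N) \sum_(r < M.+1 | (k <= r)%N)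
   (coupling_coef l n1 nb s * (recoupling_coef k s * coupling_coef (M - k) n1 (sg + 2 * k%:R) (r - k))) *: v r);
  last first.
  apply: eq_bigr => k _; rewrite inner // recoupling_racahE //.
  rewrite (big_ord_widen M.+1 (fun s => coupling_coef l n1 nb s * recoupling_coef k s)) //.
  rewrite scaler_suml; apply: eq_bigr => s _; rewrite scaler_sumr; apply: eq_bigr => r _.
  by rewrite scalerA mulrA.
rewrite (exchange_big_dep xpredT) //=; apply: eq_bigr => s _.
rewrite (exchange_big_dep (fun r : 'I_M.+1 => (s <= r)%N)) /=; last first.
  by move=> k r sk kr; apply: leq_trans kr.
under eq_bigr => r sr do rewrite -scaler_suml -mulr_sumr core //.
rewrite (bigD1 s) //= eqxx mulr1 big1 ?addr0 // => r /andP[_ /negbTE ->].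
by rewrite mulr0 scale0r.
Qed.
End Recoupling.

Section DunklRecoupling.
Variables (F : numFieldType) (n : nat) (mu : 'I_n -> F).
Implicit Types (f g : {mpoly F[n]}) (A B C : {set 'I_n}).
Let E A : {mpoly F[n]} := raise F A.

Lemma lower_raise_disjoint A B g : [disjoint A & B] ->
  lower mu A (E B * g) = E B * lower mu A g.
Proof.
by rewrite -setI_eq0 => /eqP AB; rewrite lower_raise AB weight0 scaler0 addr0.
Qed.

Lemma weight_raise_disjoint A B g : [disjoint A & B] ->
  weight mu A (E B * g) = E B * weight mu A g.
Proof.
by rewrite -setI_eq0 => /eqP AB; rewrite weight_raise AB raise0 mul0r scaler0 addr0.
Qed.

Lemma lowest_coupling_out A B C m a b c f : [disjoint A & B] -> [disjoint A & C] ->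
  lowest mu A a f -> lowest mu A a (coupling m b c (E B) (E C) * f).
Proof.
move=> dB dC [LA WA]; split.
  rewrite (coupling_comm (P := lower mu A)) /= ?LA ?mulr0 // => g; exact: lower_raise_disjoint.
rewrite (coupling_comm (P := weight mu A)) /= ?WA ?scalerAr // => g; exact: weight_raise_disjoint.
Qed.

Lemma coupling_coefS m a b s : 0 < b -> coupling_coef m a b s.+1 * (s.+1%:R * (b + s%:R)) =
  coupling_coef m a b s * (- m%:R + s%:R) * (m%:R + a + b - 1 + s%:R) :> F.
Proof.
move=> b0; rewrite /coupling_coef !pochSr factS natrM.
have f1 := fact_neq0 F s; have p1 := poch_neq0 s b0.
have p2 : b + s%:R != 0 by rewrite lt0r_neq0 // ltr_wpDr.
have p3 : s.+1%:R != 0 :> F by rewrite pnatr_eq0.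
by move: p3; rewrite -natr1 => p3; field; rewrite f1 p1 p2 p3.
Qed.

(** Lowering the s-th term gives one multiple of E^(m-s) E_B^(s-1) f and one of
    E^(m-s-1) E_B^s f; consecutive terms cancel by the two-term recurrence
    [coupling_coefS]. *)
Lemma lowest_coupling A B m a b f : 0 < b -> [disjoint A & B] ->
  lowest mu A a f -> lowest mu B b f ->
  lowest mu (A :|: B) (a + b + 2 * m%:R) (coupling m a b (E A) (E B) * f).
Proof.
move=> b0 dAB lA lB.
have EU : E A + E B = E (A :|: B) by rewrite /E raiseU.
have Wg s : weight mu (A :|: B) (E B ^+ s * f) = (a + b + 2 * s%:R) *: (E B ^+ s * f).
  rewrite weightU // (weight_raise_exp s lB.2).
  by rewrite (lowest_raise_exp s dAB lA).2 -scalerDl addrA.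
have Lg s : lower mu (A :|: B) (E B ^+ s * f)
    = (4 * s%:R * (b + s%:R - 1)) *: (E B ^+ s.-1 * f).
  rewrite lowerU // (lowest_raise_exp s dAB lA).1 add0r.
  by rewrite (lower_raise_exp s lB.2) lB.1 mulr0 add0r.
rewrite /coupling EU mulr_suml; split; rewrite linear_sum /=; last first.
  rewrite scaler_sumr; apply: eq_bigr => s _.
  rewrite -scalerAl -mulrA linearZ /= (weight_raise_exp _ (Wg s)) !scalerA mulrC.
  by congr (_ * _ *: _); rewrite natrB; [ring | rewrite -ltnS].
(* For m > 0 the first sum starts at s = 1 and the second one stops at s = m - 1:
   after a shift by one they cancel term by term. *)
case: m => [|m].
  rewrite big_ord1 -scalerAl -mulrA linearZ /= mul1r Lg.
  by rewrite mulr0 mul0r scale0r scaler0.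
pose v s := E (A :|: B) ^+ (m - s) * (E B ^+ s * f).
transitivity (\sum_(s < m.+2) (coupling_coef m.+1 a b s * (4 * s%:R * (b + s%:R - 1))) *:
     (E (A :|: B) ^+ (m.+1 - s) * (E B ^+ s.-1 * f))
  + \sum_(s < m.+2) (coupling_coef m.+1 a b s * (4 * (m.+1 - s)%:R *
     (a + b + 2 * s%:R + (m.+1 - s)%:R - 1))) *:
     (E (A :|: B) ^+ (m.+1 - s).-1 * (E B ^+ s * f))).
  rewrite -big_split; apply: eq_bigr => s _ /=.
  rewrite -scalerAl linearZ /= -[E _ ^+ _ * _ * f]mulrA (lower_raise_exp _ (Wg s)) Lg scalerDr.
  by rewrite -scalerAr !scalerA.
rewrite big_ord_recl [X in _ + X]big_ord_recr /= subnn.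
rewrite !(mulr0n, mulr0, mul0r, scale0r, add0r, addr0) -big_split big1 // => s _ /=.
have sm : (s <= m)%N by rewrite -ltnS.
rewrite /bump /= add1n subSS /= subSn //= -scalerDl.
rewrite [X in X *: _](_ : _ = 4 * (coupling_coef m.+1 a b s.+1 * (s.+1%:R * (b + s%:R))
   + coupling_coef m.+1 a b s * (m.+1 - s)%:R * (a + b + s%:R + m%:R))); last first.
  by rewrite subSn // -!natr1 natrB //; ring.
rewrite coupling_coefS // natrB ?(leq_trans sm) //.
by rewrite [X in X *: _](_ : _ = 0) ?scale0r // -!natr1; ring.
Qed.

(** Associativity of coupling.  Both sides are annihilated by the lowering
    operator of the union, hence comparing them modulo y_i^2 suffices. *)
Lemma racah_recoupling A B i (n1 nb n3 : F) l M f :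
  0 < mu i -> [disjoint A & B] -> i \notin A -> i \notin B ->
  0 < nb -> 0 < n3 -> 1 < nb + n3 -> (l <= M)%N ->
  lowest mu A n1 f -> lowest mu B nb f -> lowest mu [set i] n3 f ->
  coupling (M - l) (n1 + nb + 2 * l%:R) n3 (E A + E B) (E [set i]) * coupling l n1 nb (E A) (E B) * f =
  \sum_(k < M.+1) (recoupling_gauge nb n3 k * recoupling_racah n1 nb n3 M l k) *:
    (coupling (M - k) n1 (nb + n3 + 2 * k%:R) (E A) (E B + E [set i])
      * (coupling k nb n3 (E B) (E [set i]) * f)).
Proof.
move=> mu0 dAB iA iB nb0 n30 s1 lM lA lB li.
have dAi : [disjoint A & [set i]] by rewrite disjoint_sym disjoints1.
have dBi : [disjoint B & [set i]] by rewrite disjoint_sym disjoints1.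
have diA : [disjoint [set i] & A] by rewrite disjoints1.
have diB : [disjoint [set i] & B] by rewrite disjoints1.
have dABi : [disjoint A :|: B & [set i]].
  by rewrite disjoint_sym disjoints1 inE negb_or iA.
have dAU : [disjoint A & B :|: [set i]].
  by move: dAB dAi; rewrite -!setI_eq0 setIUr => /eqP -> /eqP ->; rewrite setU0.
have EAB : E A + E B = E (A :|: B) by rewrite /E raiseU.
have EBi : E B + E [set i] = E (B :|: [set i]) by rewrite /E raiseU.
have iU : i \in A :|: B :|: [set i] by rewrite !inE eqxx orbT.
apply/eqP; rewrite -subr_eq0; apply/eqP.
set lhs := _ * f; set rhs := \sum_(_ < _) _.
have Ll : lower mu (A :|: B :|: [set i]) lhs = 0.
  rewrite /lhs -mulrA EAB; apply: (proj1 (lowest_coupling _ n30 dABi _ _)).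
    exact: lowest_coupling.
  exact: lowest_coupling_out.
have Lr : lower mu (A :|: B :|: [set i]) rhs = 0.
  rewrite /rhs linear_sum big1 // => k _; rewrite linearZ /= EBi -setUA.
  rewrite (proj1 (lowest_coupling _ _ dAU _ _)) ?scaler0 //.
  - by rewrite ltr_wpDr ?mulr_ge0 // ltr_wpDr // ltW.
  - exact: lowest_coupling_out.
  - exact: lowest_coupling.
have Ei : E [set i] = 'X_i ^+ 2 by rewrite /E /raise big_set1.
(* A lowest weight vector divisible by y_i^2 is 0. *)
suff [g gE] : congmod ('X_i ^+ 2) lhs rhs.
  by apply: (lower_eq0 mu0 iU _ gE); rewrite linearB /= Ll Lr subrr.
have Z0 : congmod ('X_i ^+ 2 : {mpoly F[n]}) ('X_i ^+ 2) 0 by exists 1; rewrite subr0 mulr1.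
have R0 p : congmod ('X_i ^+ 2 : {mpoly F[n]}) p p := congmod_refl _ p.
have -> : rhs = (\sum_(k < M.+1) (recoupling_gauge nb n3 k * recoupling_racah n1 nb n3 M l k) *:
    (coupling (M - k) n1 (nb + n3 + 2 * k%:R) (E A) (E B + E [set i])
      * coupling k nb n3 (E B) (E [set i]))) * f.
  by rewrite /rhs mulr_suml; apply: eq_bigr => k _; rewrite -[RHS]scalerAl mulrA.
apply: congmodM => //.
have [g1 E1] : congmod ('X_i ^+ 2)
   (coupling (M - l) (n1 + nb + 2 * l%:R) n3 (E A + E B) (E [set i]) * coupling l n1 nb (E A) (E B))
   ((E A + E B) ^+ (M - l) * coupling l n1 nb (E A) (E B)).
  apply: congmodM => //; rewrite -(coupling0 (M - l) (n1 + nb + 2 * l%:R) n3) Ei.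
  exact: congmod_coupling.
have [g2 E2] : congmod ('X_i ^+ 2)
   (\sum_(k < M.+1) (recoupling_gauge nb n3 k * recoupling_racah n1 nb n3 M l k) *:
    (coupling (M - k) n1 (nb + n3 + 2 * k%:R) (E A) (E B + E [set i])
      * coupling k nb n3 (E B) (E [set i])))
   (\sum_(k < M.+1) (recoupling_gauge nb n3 k * recoupling_racah n1 nb n3 M l k) *:
    (coupling (M - k) n1 (nb + n3 + 2 * k%:R) (E A) (E B) * E B ^+ k)).
  apply: congmod_sum => k; apply: congmodM.
    apply: congmod_coupling => //; rewrite -[X in congmod _ _ X]addr0 Ei; exact: congmodD.
  by rewrite -(coupling0 k nb n3) Ei; apply: congmod_coupling.
rewrite (recoupling_slice n1 _ _ nb0 s1 lM) in E1.
by exists (g1 - g2); rewrite mulrBr -E1 -E2; ring.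
Qed.

End DunklRecoupling.

Lemma big_tuple_cons (V : nmodType) (T : finType) r (G : seq T -> V) :
  \sum_(s : r.+1.-tuple T) G s = \sum_(t : T) \sum_(s : r.-tuple T) G (t :: s).
Proof.
rewrite pair_big /= (reindex (fun ts : T * r.-tuple T => cons_tuple ts.1 ts.2)) //=.
exists (fun s : r.+1.-tuple T => (thead s, behead_tuple s)) => [[t s] _|s _] /=.
  by congr (_, _); apply: val_inj.
by apply: val_inj; rewrite [in RHS](tuple_eta s).
Qed.

(** * Iterated couplings of consecutive variables *)

Section Chains.
Variables (F : numFieldType) (n : nat) (mu : 'I_n -> F) (eps : 'I_n -> bool).
Hypothesis mu_gt0 : forall j, 0 < mu j.
Implicit Types (f g : {mpoly F[n]}) (A B C : {set 'I_n}).
Let E A : {mpoly F[n]} := raise F A.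

Definition vacuum_weight A : F := \sum_(j in A) (2^-1 + mu j + (eps j)%:R).

(** y^eps, the lowest weight vector of every copy of sl(2) in the parity class
    eps. *)
Definition vacuum : {mpoly F[n]} := 'X_[[multinom nat_of_bool (eps i) | i < n]].

Lemma lowest_vacuum A : lowest mu A (vacuum_weight A) vacuum.
Proof.
split.
  rewrite /lower big1 // => j _; apply/mpolyP => m; rewrite mcoeff_dunkl_sq mcoeff0 mcoeffX.
  case: eqP => [/(congr1 (fun m : 'X_{1..n} => m j))|]; last by rewrite mulr0.
  by rewrite mnmE !mnmDE mnm1E eqxx; case: (eps j) => /=; lia.
rewrite /weight /vacuum_weight scaler_suml; apply: eq_bigr => j _; apply/mpolyP => m.
rewrite mcoeff_euler mcoeffZ mcoeffX; case: eqP => [<-|]; last by rewrite !mulr0.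
by rewrite mnmE addrC.
Qed.

Lemma vacuum_weightU A B : [disjoint A & B] ->
  vacuum_weight (A :|: B) = vacuum_weight A + vacuum_weight B.
Proof. by move=> dAB; rewrite /vacuum_weight -bigU //; apply: eq_bigl => i; rewrite !inE. Qed.

Lemma segS s i : seg s (s + i.+1) = seg s (s + i) :|: seg (s + i.+1) (s + i.+1) :> {set 'I_n}.
Proof. by apply/setP => j; rewrite !inE; lia. Qed.

Lemma seg_disjoint s t s' t' : (t < s')%N ->
  [disjoint (seg s t : {set 'I_n}) & (seg s' t' : {set 'I_n})].
Proof.
by move=> ts; rewrite -setI_eq0; apply/eqP/setP => j; rewrite !inE; lia.
Qed.

Lemma seg1P t : (0 < t <= n)%N -> exists j : 'I_n, j.+1 = t /\ seg t t = [set j].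
Proof.
case: t => // t tn; exists (Ordinal tn); split=> //.
by apply/setP => j; rewrite !inE -val_eqE /=; lia.
Qed.

(** Each variable contributes 1/2 + mu_j + eps_j > 1/2; this bound keeps every
    denominator away from 0 and the arguments of kappa positive. *)
Lemma vacuum_weight_gt s i : (0 < s)%N -> (s + i <= n)%N ->
  i.+1%:R / 2 < vacuum_weight (seg s (s + i)).
Proof.
have one t : (0 < t <= n)%N -> 2^-1 < vacuum_weight (seg t t).
  move=> tn; have [j [_ ->]] := seg1P tn; rewrite /vacuum_weight big_set1 -addrA ltrDl.
  by rewrite ltr_wpDr.
move=> s0; elim: i => [|i IHi] sn; first by rewrite addn0 div1r one //; lia.
rewrite segS vacuum_weightU; last by apply: seg_disjoint; lia.
rewrite -addn1 natrD mulrDl div1r ltrD ?IHi ?one //; lia.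
Qed.

(** The coupling of y_s, ..., y_(s+i) with y_(s+i+1) which raises the level from
    x i to x (i+1). *)
Definition chain_factor s (x : nat -> nat) i : {mpoly F[n]} :=
  coupling (x i.+1 - x i) (vacuum_weight (seg s (s + i)) + 2 * (x i)%:R)
    (vacuum_weight (seg (s + i.+1) (s + i.+1)))
    (E (seg s (s + i))) (E (seg (s + i.+1) (s + i.+1))).

Definition chain s x r : {mpoly F[n]} := \prod_(i < r) chain_factor s x i.

Lemma chainS s x r : chain s x r.+1 = chain_factor s x r * chain s x r.
Proof. by rewrite /chain big_ord_recr mulrC. Qed.

Lemma lowest_chain_out s x r A : (forall i, (i <= r)%N -> [disjoint A & seg s (s + i)]) ->
  lowest mu A (vacuum_weight A) (chain s x r * vacuum).
Proof.
elim: r => [|r IHr] dA; first by rewrite /chain big_ord0 mul1r; exact: lowest_vacuum.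
rewrite chainS -mulrA; apply: lowest_coupling_out; first by apply: dA.
  have := dA _ (leqnn r.+1); apply: disjointWr; apply/subsetP => j; rewrite !inE; lia.
by apply: IHr => i ir; apply: dA; rewrite leqW.
Qed.

Lemma lowest_chain s x r : (0 < s)%N -> (s + r <= n)%N -> x 0%N = 0%N ->
  (forall i, (i < r)%N -> (x i <= x i.+1)%N) ->
  lowest mu (seg s (s + r)) (vacuum_weight (seg s (s + r)) + 2 * (x r)%:R)
    (chain s x r * vacuum).
Proof.
move=> s0 + x0; elim: r => [|r IHr] sn xle.
  by rewrite /chain big_ord0 mul1r x0 mulr0 addr0; exact: lowest_vacuum.
rewrite segS vacuum_weightU; last by apply: seg_disjoint; lia.
rewrite [X in lowest _ _ X](_ : _ = vacuum_weight (seg s (s + r)) + 2 * (x r)%:R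
  + vacuum_weight (seg (s + r.+1) (s + r.+1)) + 2 * (x r.+1 - x r)%:R); last first.
  by rewrite natrB ?xle //; ring.
rewrite chainS -mulrA; apply: lowest_coupling.
- have := @vacuum_weight_gt (s + r.+1) 0; rewrite addn0 => /(_ _ sn) h.
  by apply: lt_trans (h _); rewrite ?divr_gt0 //; lia.
- by apply: seg_disjoint; lia.
- by apply: IHr => [|i ir]; [lia | apply: xle; lia].
- by apply: lowest_chain_out => i ir; rewrite disjoint_sym; apply: seg_disjoint; lia.
Qed.

(** The first m factors give a lowest weight vector for [s..s+m]; every later
    factor is a polynomial in elements E_B with B containing [s..s+m] or disjoint
    from it. *)
Lemma casimir_chain s x m r : (0 < s)%N -> (m <= r)%N -> (s + r <= n)%N -> x 0%N = 0%N ->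
  (forall i, (i < r)%N -> (x i <= x i.+1)%N) ->
  let a := vacuum_weight (seg s (s + m)) + 2 * (x m)%:R in
  casimir mu (seg s (s + m)) (chain s x r * vacuum) = (a / 2) * (a / 2 - 1) *: (chain s x r * vacuum).
Proof.
move=> s0 mr + x0; rewrite -(subnKC mr); elim: (r - m)%N => [|d IHd] sn xle a.
  by rewrite addn0 in sn xle *; apply: casimir_lowest; apply: lowest_chain.
rewrite addnS chainS -mulrA (coupling_comm (P := casimir mu (seg s (s + m)))) /=.
- rewrite IHd ?scalerAr //; first by lia.
  by move=> i ir; apply: xle; lia.
- by move=> g; apply: casimir_raise_sub; apply/subsetP => j; rewrite !inE; lia.
- by move=> g; apply: casimir_raise_disjoint; apply: seg_disjoint; lia.
Qed.

Lemma meval_raise A i : (E A).@[fun j => (j == i)%:R] = (i \in A)%:R.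
Proof.
rewrite /E /raise raddf_sum /=; have h j : ('X_j ^+ 2 : {mpoly F[n]}).@[fun j => (j == i)%:R] = (j == i)%:R.
  by rewrite rmorphXn /= mevalXU; case: eqP; rewrite ?expr1n ?expr0n.
rewrite (eq_bigr _ (fun j _ => h j)); case: (boolP (i \in A)) => iA.
  by rewrite (bigD1 i) //= eqxx big1 ?addr0 // => j /andP[_ /negbTE ->].
by rewrite big1 // => j jA; case: eqP => // ji; rewrite -ji jA in iA.
Qed.

Lemma vacuum_neq0 : vacuum != 0.
Proof.
apply/eqP => /(congr1 (mcoeff [multinom nat_of_bool (eps i) | i < n])).
by rewrite mcoeffX eqxx mcoeff0 => /eqP; rewrite oner_eq0.
Qed.

Lemma coupling_raise_neq0 m a b A B i : i \in A -> i \notin B -> coupling m a b (E A) (E B) != 0.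
Proof.
move=> iA /negbTE iB; apply/eqP => /(congr1 (meval (fun j => (j == i)%:R))).
by rewrite meval0 meval_coupling ?meval_raise ?iA ?iB // => /eqP; rewrite oner_eq0.
Qed.

Lemma chain_neq0 s x r : (0 < s <= n)%N -> chain s x r != 0.
Proof.
move=> sn; have [j [js _]] := seg1P sn; apply/prodf_neq0 => i _.
by apply: (@coupling_raise_neq0 _ _ _ _ _ j); rewrite inE; lia.
Qed.

Lemma mdeg_lowest A w m f : lowest mu A w f -> f@_m != 0 ->
  \sum_(j in A) ((m j)%:R + (2^-1 + mu j)) = w.
Proof.
move=> [_ /(congr1 (mcoeff m))]; rewrite mcoeffZ /weight raddf_sum /=.
by rewrite (eq_bigr _ (fun j _ => mcoeff_euler mu j f m)) -mulr_suml => /mulIf h /h.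
Qed.

Lemma refl_raise i A g : refl i (E A * g) = E A * refl i g.
Proof.
rewrite /refl rmorphM /=; congr (_ * _); rewrite -/(refl i _) /E /raise /refl raddf_sum.
apply: eq_bigr => j _ /=; rewrite rmorphXn /= comp_mpolyXU -tnth_nth tnth_mktuple.
by case: eqP => // _; rewrite sqrrN.
Qed.

Lemma refl_coupling i m a b A B g :
  refl i (coupling m a b (E A) (E B) * g) = coupling m a b (E A) (E B) * refl i g.
Proof. by apply: (coupling_comm (P := comp_mpoly _)) => p; apply: refl_raise. Qed.

Lemma refl_chain i s x r g : refl i (chain s x r * g) = chain s x r * refl i g.
Proof.
elim: r => [|r IHr]; first by rewrite /chain big_ord0 !mul1r.
by rewrite chainS -!mulrA refl_coupling IHr.
Qed.

Lemma refl_vacuum i : refl i vacuum = (-1) ^+ eps i *: vacuum.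
Proof. by rewrite reflX mnmE. Qed.

(** The weight operator is diagonal on monomials, so that its eigenvalue fixes
    the degree. *)
Lemma harmonic_lowest f N : lowest mu [set: 'I_n] (vacuum_weight setT + 2 * N%:R) f ->
  (forall i, refl i f = (-1) ^+ eps i *: f) ->
  dunkl_harmonic mu (2 * N + \sum_(j < n) eps j)%N eps f.
Proof.
move=> lf rf; split=> //; last first.
  rewrite -lf.1 /dunkl_laplacian /lower; apply: eq_big => [j|j _]; first by rewrite inE.
  by rewrite dunkl_sq.unlock.
apply/dhomogP => m; rewrite mcoeff_msupp => /(mdeg_lowest lf).
rewrite /vacuum_weight !big_split /= -!natr_sum => wE.
have sumT (G : 'I_n -> nat) : (\sum_(j in setT) G j = \sum_j G j)%N.
  by apply: eq_bigl => j; rewrite inE.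
apply/eqP; rewrite mdegE -(eqr_nat F) natrD natrM -!sumT.
apply/eqP; apply: (addIr (\sum_(i in [set: 'I_n]) 2^-1 + \sum_(i in setT) mu i)).
by rewrite wE; ring.
Qed.

(** In each term either (-l)_s = 0, when l < s, or (-M + s)_(k-s) = 0. *)
Lemma recoupling_racah_eq0 (n1 nb n3 : F) M l k : (l <= M)%N -> (M < k)%N ->
  recoupling_racah n1 nb n3 M l k = 0.
Proof.
move=> lM Mk; rewrite /recoupling_racah /racah big1 // => s _.
have [ls|sl] := ltnP l s; first by rewrite (poch_eq0 F ls) mulr0 !mul0r.
have -> : - M%:R - 1 + 1 + s%:R = - (M - s)%:R :> F.
  by rewrite natrB ?(leq_trans sl) //; ring.
by rewrite (@poch_eq0 F (k - s) (M - s)) ?mulr0 //; lia.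
Qed.

Variables (p N : nat) (xs : nat -> nat).
Hypotheses (pn : (p.+2 <= n)%N) (xsp : xs p = N)
  (xs_le : forall i, (i <= p)%N -> (xs i <= N)%N)
  (xs_mono : forall i, (i < p)%N -> (xs i <= xs i.+1)%N).

Let nu s t := vacuum_weight (seg s t).
Let x' i := if i is j.+1 then xs j else 0%N.

(** The coupling of [2..i+2], already at level K, with y_(i+3) at level k. *)
Definition phi_factor i (K k : nat) : {mpoly F[n]} :=
  coupling k (nu 2 i.+2 + 2 * K%:R) (nu i.+3 i.+3) (E (seg 2 i.+2)) (E (seg i.+3 i.+3)).

(** The couplings still to be made after i recouplings: y_1 is coupled with
    [2..i+2], which is at level K, and the variables y_(i+3), ... are then added as
    in the psi scheme.  Thus i = 0 is the psi scheme, and for i = p only the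
    coupling of y_1 remains. *)
Definition hybrid i (K : nat) : {mpoly F[n]} :=
  coupling (xs i - K) (nu 1 1) (nu 2 i.+2 + 2 * K%:R) (E (seg 1 1)) (E (seg 2 i.+2))
    * \prod_(i <= h < p) chain_factor 1 x' h.+1.

(** The differences of labels are taken in F, so that this is a factor of
    [multi_racah] even when K > xs i; [hybrid_racahE] covers the labels that occur
    with nonzero coefficient. *)
Definition hybrid_racah i (K k : nat) : F :=
  racah k (nu 2 i.+2 + 2 * K%:R - 1) (nu i.+3 i.+3 - 1)
    (K%:R - (xs i.+1)%:R - 1) (nu 1 1 + nu 2 i.+2 + K%:R - 1 + (xs i.+1)%:R)
    (- K%:R + (xs i)%:R).

Definition hybrid_gauge i (K k : nat) : F :=
  recoupling_gauge (nu 2 i.+2 + 2 * K%:R) (nu i.+3 i.+3) k.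

Lemma hybrid_racahE i K k : (i < p)%N -> (K <= xs i)%N ->
  hybrid_racah i K k = recoupling_racah (nu 1 1) (nu 2 i.+2 + 2 * K%:R) (nu i.+3 i.+3)
    (xs i.+1 - K) (xs i - K) k.
Proof.
move=> ip Kx; have xx := xs_mono ip; rewrite /hybrid_racah /recoupling_racah.
rewrite !natrB ?(leq_trans Kx) //; congr racah; ring.
Qed.

(** A step that would make |k| exceed the label xs (i+1) has coefficient 0;
    therefore truncated subtraction is harmless in the sums below. *)
Lemma hybrid_racah_eq0 i K k : (i < p)%N -> (K <= xs i)%N -> (xs i.+1 < K + k)%N ->
  hybrid_racah i K k = 0.
Proof.
move=> ip Kx Kk; have xx := xs_mono ip.
by rewrite hybrid_racahE // recoupling_racah_eq0 //; lia.
Qed.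

Lemma hybrid_step i K f : (i < p)%N -> (K <= xs i)%N ->
  lowest mu (seg 1 1) (nu 1 1) f ->
  lowest mu (seg 2 i.+2) (nu 2 i.+2 + 2 * K%:R) f ->
  lowest mu (seg i.+3 i.+3) (nu i.+3 i.+3) f ->
  hybrid i K * f = \sum_(k < N.+1) (hybrid_gauge i K k * hybrid_racah i K k) *:
     (hybrid i.+1 (K + k) * (phi_factor i K k * f)).
Proof.
move=> ip Kx l1 l2 l3; have xx := xs_mono ip.
have ij : (0 < i.+3 <= n)%N by lia.
have [j [jE segj]] := seg1P ij.
have xN : (xs i.+1 - K <= N)%N by rewrite (leq_trans (leq_subr _ _)) ?xs_le.
have d1B : [disjoint (seg 1 1 : {set 'I_n}) & seg 2 i.+2] by apply: seg_disjoint.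
have jA : j \notin seg 1 1 by rewrite inE; lia.
have jB : j \notin seg 2 i.+2 by rewrite inE; lia.
have seg12 : seg 1 1 :|: seg 2 i.+2 = seg 1 i.+2 :> {set 'I_n}.
  by apply/setP => h; rewrite !inE; lia.
have seg23 : seg 2 i.+2 :|: [set j] = seg 2 i.+3 :> {set 'I_n}.
  by rewrite -segj; apply/setP => h; rewrite !inE; lia.
have nuB : i.+1%:R / 2 < nu 2 i.+2 by apply: (@vacuum_weight_gt 2 i) => //; lia.
have nuj : 1%:R / 2 < nu i.+3 i.+3.
  have := @vacuum_weight_gt i.+3 0; rewrite addn0; apply=> //; lia.
have half0 k : 0 <= k%:R / 2 :> F by rewrite divr_ge0.
have nuB0 : 0 < nu 2 i.+2 + 2 * K%:R.
  by rewrite ltr_wpDr ?mulr_ge0 // (le_lt_trans _ nuB).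
have nuj0 : 0 < nu i.+3 i.+3 by rewrite (le_lt_trans _ nuj).
have nuBj : 1 < nu 2 i.+2 + 2 * K%:R + nu i.+3 i.+3.
  rewrite addrAC ltr_wpDr ?mulr_ge0 // (_ : 1 = 1%:R / 2 + 1%:R / 2 :> F); last by field.
  by apply: ltrD => //; apply: le_lt_trans nuB; rewrite ler_pM2r ?invr_gt0 // ler_nat.
rewrite -(sum_ord_widen0 (G := fun k => (hybrid_gauge i K k * hybrid_racah i K k) *:
     (hybrid i.+1 (K + k) * (phi_factor i K k * f))) xN); last first.
  by move=> k kM; rewrite hybrid_racah_eq0 ?mulr0 ?scale0r //; lia.
pose rest := \prod_(i.+1 <= h < p) chain_factor 1 x' h.+1.
have lMM : (xs i - K <= xs i.+1 - K)%N by lia.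
have := racah_recoupling (mu_gt0 j) d1B jA jB nuB0 nuj0 nuBj lMM l1 l2.
rewrite -segj => /(_ l3) E1.
have EU : raise F (seg 2 i.+2) + raise F (seg i.+3 i.+3) = E (seg 2 i.+3).
  by rewrite segj -raiseU ?seg23 // disjoint_sym disjoints1.
transitivity (rest * (\sum_(k < (xs i.+1 - K).+1)
   (hybrid_gauge i K k * hybrid_racah i K k) *:
     (coupling (xs i.+1 - (K + k)) (nu 1 1) (nu 2 i.+3 + 2 * (K + k)%:R)
        (E (seg 1 1)) (E (seg 2 i.+3)) * (phi_factor i K k * f)))); last first.
  rewrite mulr_sumr; apply: eq_bigr => k _; rewrite -scalerAr /hybrid /rest.
  by congr (_ *: _); rewrite mulrCA; exact: mulrA.
rewrite (eq_bigr (fun k : 'I_(xs i.+1 - K).+1 =>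
   (recoupling_gauge (nu 2 i.+2 + 2 * K%:R) (nu i.+3 i.+3) k *
     recoupling_racah (nu 1 1) (nu 2 i.+2 + 2 * K%:R) (nu i.+3 i.+3) (xs i.+1 - K) (xs i - K) k) *:
     (coupling (xs i.+1 - K - k) (nu 1 1) (nu 2 i.+2 + 2 * K%:R + nu i.+3 i.+3 + 2 * k%:R)
        (raise F (seg 1 1)) (raise F (seg 2 i.+2) + raise F (seg i.+3 i.+3)) *
         (coupling k (nu 2 i.+2 + 2 * K%:R) (nu i.+3 i.+3) (raise F (seg 2 i.+2))
           (raise F (seg i.+3 i.+3)) * f)))); last first.
  move=> k _; rewrite hybrid_racahE // -subnDA EU.
  congr (_ *: (coupling _ _ _ _ _ * _)).
  rewrite [nu 2 i.+3](_ : _ = nu 2 i.+2 + nu i.+3 i.+3); first by rewrite natrD; ring.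
  by rewrite /nu -seg23 -segj vacuum_weightU // segj disjoint_sym disjoints1.
have -> : hybrid i K * f = rest * (chain_factor 1 x' i.+1 *
   coupling (xs i - K) (nu 1 1) (nu 2 i.+2 + 2 * K%:R) (E (seg 1 1)) (E (seg 2 i.+2)) * f).
  by rewrite /hybrid big_ltn // -/rest; ring.
rewrite -E1; congr (_ * (_ * _ * _)); rewrite /chain_factor /= -raiseU // seg12.
congr (coupling _ _ _ _ _); first by lia.
rewrite [vacuum_weight (seg 1 _)](_ : _ = nu 1 1 + nu 2 i.+2); last first.
  by rewrite /nu -vacuum_weightU // seg12.
by rewrite natrB //; ring.
Qed.

(** Iterating the recoupling produces a sum over sequences k_1, k_2, ...; K is
    the partial sum of the entries already read. *)
Fixpoint path_coef i (K : nat) (s : seq nat) : F :=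
  if s is k :: s' then hybrid_gauge i K k * hybrid_racah i K k * path_coef i.+1 (K + k) s'
  else 1.

Fixpoint path_poly i (K : nat) (s : seq nat) : {mpoly F[n]} :=
  if s is k :: s' then path_poly i.+1 (K + k) s' * phi_factor i K k else 1.

Lemma path_coef_eq0 i K s : (i + size s <= p)%N -> (K <= xs i)%N ->
  (xs (i + size s) < K + sumn s)%N -> path_coef i K s = 0.
Proof.
elim: s i K => [|k s IHs] i K /=; first by rewrite !addn0 => _; lia.
rewrite !addnS -!addSn addnA => ip Kx xK.
have [Kk|Kk] := leqP (K + k) (xs i.+1).
  by rewrite IHs ?mulr0 //.
by rewrite hybrid_racah_eq0 ?mulr0 ?mul0r //; lia.
Qed.

Lemma hybrid_paths r i K f : (i + r = p)%N -> (K <= xs i)%N ->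
  lowest mu (seg 1 1) (nu 1 1) f ->
  lowest mu (seg 2 i.+2) (nu 2 i.+2 + 2 * K%:R) f ->
  (forall h, (i <= h)%N -> lowest mu (seg h.+3 h.+3) (nu h.+3 h.+3) f) ->
  hybrid i K * f = \sum_(s : r.-tuple 'I_N.+1) path_coef i K (map val s) *:
     (hybrid p (K + sumn (map val s)) * (path_poly i K (map val s) * f)).
Proof.
elim: r i K f => [|r IHr] i K f.
  rewrite addn0 => -> Kx _ _ _; rewrite (big_pred1 [tuple]) => [|s]; last by apply/esym/eqP; exact: tuple0.
  by rewrite /= addn0 scale1r mul1r.
rewrite addnS => ip Kx l1 l2 l3.
have ip' : (i < p)%N by lia.
rewrite (hybrid_step ip' Kx l1 l2 (l3 _ (leqnn i))).
rewrite (@big_tuple_cons _ _ r (fun s : seq 'I_N.+1 => path_coef i K (map val s) *: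
     (hybrid p (K + sumn (map val s)) * (path_poly i K (map val s) * f)))).
apply: eq_bigr => k _ /=.
have [Kk|Kk] := leqP (K + k) (xs i.+1); last first.
  rewrite hybrid_racah_eq0 // mulr0 scale0r big1 // => s _.
  by rewrite mul0r scale0r.
rewrite (IHr i.+1) //.
- by rewrite scaler_sumr; apply: eq_bigr => s _; rewrite scalerA addnA; congr (_ *: (_ * _)); exact: mulrA.
- by apply: lowest_coupling_out => //; apply: seg_disjoint.
- have segU : seg 2 i.+2 :|: seg i.+3 i.+3 = seg 2 i.+3 :> {set 'I_n}.
    by apply/setP => h; rewrite !inE; lia.
  have dj : [disjoint (seg 2 i.+2 : {set 'I_n}) & seg i.+3 i.+3] by apply: seg_disjoint.
  rewrite -segU [X in lowest _ _ X](_ : _ = nu 2 i.+2 + 2 * K%:R + nu i.+3 i.+3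
     + 2 * (k : nat)%:R); last first.
    by rewrite natrD /nu -segU vacuum_weightU //; ring.
  apply: lowest_coupling => //; last exact: l3.
  have := @vacuum_weight_gt i.+3 0; rewrite addn0 => h.
  by apply: lt_trans (h _ _); rewrite ?divr_gt0 //; lia.
- move=> h ih; apply: lowest_coupling_out.
  + by rewrite disjoint_sym; apply: seg_disjoint; lia.
  + by rewrite disjoint_sym; apply: seg_disjoint; lia.
  + by apply: l3; lia.
Qed.

Lemma path_polyE s : path_poly 0 0 s = chain 2 (fun i => sumn (take i s)) (size s).
Proof.
suff H i K x : (forall h, (h <= size s)%N -> x (i + h)%N = (K + sumn (take h s))%N) ->
    path_poly i K s = \prod_(h < size s) chain_factor 2 x (i + h).
  by rewrite (H _ _ (fun i => sumn (take i s))).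
elim: s i K => [|k s IHs] i K xE /=; first by rewrite big_ord0.
rewrite big_ord_recl addn0 mulrC; congr (_ * _).
  rewrite /phi_factor /chain_factor; have := xE 0%N isT; rewrite addn0 take0 addn0 => ->.
  have := xE 1%N isT; rewrite addn1 /= take0 addn0 => ->.
  by rewrite addKn.
rewrite (IHs i.+1); last first.
  by move=> h hs; rewrite addSnnS xE //= addnA.
by apply: eq_bigr => h _; rewrite /= /bump add1n addSnnS.
Qed.

Lemma path_coefE s : path_coef 0 0 s =
  (\prod_(i < size s) hybrid_gauge i (sumn (take i s)) (nth 0%N s i)) *
  (\prod_(i < size s) hybrid_racah i (sumn (take i s)) (nth 0%N s i)).
Proof.
rewrite -big_split /=.
suff H i K : path_coef i K s = \prod_(h < size s)
   (hybrid_gauge (i + h) (K + sumn (take h s)) (nth 0%N s h)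
     * hybrid_racah (i + h) (K + sumn (take h s)) (nth 0%N s h)).
  exact: H.
elim: s i K => [|k s IHs] i K /=; first by rewrite big_ord0.
rewrite big_ord_recl /= !addn0 IHs; congr (_ * _).
by apply: eq_bigr => h _; rewrite /= /bump add1n addSnnS addnA.
Qed.

End Chains.

(** * Partial sums of multi-indices *)

Section Multinomials.

Lemma sumn_take (s : seq nat) j :
  sumn (take j s) = (\sum_(i < size s | (i < j)%N) nth 0 s i)%N.
Proof.
rewrite big_mkcond; elim: s j => [|a s IHs] [|j] //=; rewrite ?big_ord0 //.
  by rewrite big1 // => i _; rewrite ltn0.
by rewrite big_ord_recl /= IHs; congr addn; apply: eq_bigr.
Qed.

Lemma psumE p (k : 'X_{1..p}) j : psum k j = sumn (take j k).
Proof.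
rewrite sumn_take /psum size_tuple; apply: eq_bigr => i _.
by rewrite [LHS](tnth_nth 0%N).
Qed.

Lemma psum_mono p (k : 'X_{1..p}) i j : (i <= j)%N -> (psum k i <= psum k j)%N.
Proof.
move=> ij; rewrite /psum big_mkcond [X in (_ <= X)%N]big_mkcond.
by apply: leq_sum => h _; case: ltnP => // hi; rewrite (leq_trans hi ij).
Qed.

Lemma psum_mdeg p (k : 'X_{1..p}) : psum k p = mdeg k.
Proof. by rewrite mdegE /psum; apply: eq_bigl => i; rewrite ltn_ord. Qed.

Lemma psum0 p (k : 'X_{1..p}) : psum k 0 = 0%N.
Proof. by rewrite /psum big1. Qed.

Lemma psumS p (k : 'X_{1..p}) (i : 'I_p) : psum k i.+1 = (psum k i + k i)%N.
Proof.
rewrite /psum (bigD1 i) //= addnC; congr addn; apply: eq_bigl => j.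
by rewrite ltnS -val_eqE /=; lia.
Qed.

Lemma psum_inj p (k k' : 'X_{1..p}) :
  (forall j, (0 < j <= p)%N -> psum k j = psum k' j) -> k = k'.
Proof.
move=> kk; apply/mnmP => i; apply: (@addnI (psum k i)); rewrite -psumS.
have -> : psum k i = psum k' i.
  by case: (posnP i) => [->|i0]; rewrite ?psum0 // kk // i0 ltnW.
by rewrite -psumS kk // ltn_ord.
Qed.

Lemma big_tuple_bmultinom (V : nmodType) p N (G : seq nat -> V) :
  (forall s, size s = p -> (N < sumn s)%N -> G s = 0) ->
  \sum_(s : p.-tuple 'I_N.+1) G (map val s) = \sum_(k : 'X_{1..p < N.+1}) G (k : 'X_{1..p}).
Proof.
move=> G0; rewrite (bigID (fun s : p.-tuple 'I_N.+1 => (sumn (map val s) < N.+1)%N)) /=.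
rewrite [X in _ + X]big1 ?addr0; last first.
  by move=> s; rewrite -leqNgt => sN; rewrite G0 // size_map size_tuple.
pose h (k : 'X_{1..p < N.+1}) : p.-tuple 'I_N.+1 := [tuple inord (bmnm k i) | i < p].
pose h' (s : p.-tuple 'I_N.+1) : 'X_{1..p < N.+1} :=
  insubd bm0 (Multinom (map_tuple val s)).
have hE k : map val (h k) = bmnm k :> seq nat.
  apply: (@eq_from_nth _ 0%N); first by rewrite size_map !size_tuple.
  move=> i; rewrite size_map size_tuple => ip.
  rewrite (nth_map ord0) ?size_tuple // -(tnth_nth _ _ (Ordinal ip)) tnth_mktuple /= inordK.
    by rewrite [LHS](tnth_nth 0%N).
  have kN : (mdeg (bmnm k) < N.+1)%N := valP k.
  by apply: leq_trans kN; rewrite ltnS mdegE (bigD1 (Ordinal ip)) //= leq_addr.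
etransitivity; first apply: (reindex_onto h h').
  move=> s sN; apply: val_inj; apply: (inj_map val_inj); rewrite hE /h'.
  by rewrite -[bmnm _]/(val _) val_insubd /= /mdeg -sumnE sN.
apply: eq_big => [k|k _]; last by rewrite hE.
rewrite hE /mdeg sumnE; have := valP k; rewrite /= /mdeg => kN; rewrite kN /=.
apply/eqP; apply: val_inj; rewrite /h' val_insubd /=.
have -> : Multinom (map_tuple val (h k)) = bmnm k by apply: val_inj; apply: val_inj; apply: hE.
by rewrite kN.
Qed.

End Multinomials.

(** * The two joint eigenbases *)

(** A vector of H with the eigenvalues of b i has no component on b j for j <> i,
    because some operator separates i from j. *)
Lemma eigenvector_unique (F : numFieldType) (V : lmodType F) (I : finType)
  (H : V -> Prop) (b : I -> V) (op : nat -> {linear V -> V}) (ev : I -> nat -> F)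
  (dom : pred nat) :
  is_basis H b -> (forall i m, dom m -> op m (b i) = ev i m *: b i) ->
  (forall i j, (forall m, dom m -> ev i m = ev j m) -> i = j) ->
  forall v i, H v -> (forall m, dom m -> op m v = ev i m *: v) ->
  exists c, v = c *: b i.
Proof.
move=> [_ b_free b_span] b_ev ev_sep v i /b_span[c cE] v_ev.
exists (c i); rewrite cE (bigD1 i) //= big1 ?addr0 // => j ji.
apply/eqP; rewrite scaler_eq0; apply/orP; left; apply/negPn/negP => cj.
case/eqP: ji; apply: ev_sep => m dm; apply/eqP; rewrite -subr_eq0.
have /b_free/(_ j)/eqP : \sum_j (c j * (ev j m - ev i m)) *: b j = 0.
  have := v_ev _ dm; rewrite cE linear_sum scaler_sumr => /eqP.
  rewrite -subr_eq0 -sumrB => /eqP e; rewrite -[RHS]e; apply: eq_bigr => h _.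
  by rewrite linearZ /= b_ev // !scalerA -scalerBl mulrBr [ev i m * _]mulrC.
by rewrite mulf_eq0 (negbTE cj).
Qed.

Lemma kappa_inj (F : numFieldType) (b : F) (x y : nat) :
  0 < b -> kappa x%:R b = kappa y%:R b -> x = y.
Proof.
move=> b0 /eqP; rewrite -subr_eq0.
have -> : kappa x%:R b - kappa y%:R b = (x%:R - y%:R) * (x%:R + y%:R + b).
  by rewrite /kappa; field.
rewrite mulf_eq0 orbC gt_eqF ?ltr_wpDl ?addr_ge0 //= subr_eq0 eqr_nat.
by move/eqP.
Qed.

Lemma kappaE (F : numFieldType) (a x : F) :
  (a + 2 * x) / 2 * ((a + 2 * x) / 2 - 1) = kappa x (a - 1).
Proof. by rewrite /kappa; field. Qed.

Section JointEigenbases.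
Variables (F : numFieldType) (n : nat) (mu : 'I_n -> F) (eps : 'I_n -> bool).
Hypothesis mu_gt0 : forall j, 0 < mu j.
Variables (p N : nat).
Hypothesis np : n = p.+2.
Let nu s t := vacuum_weight mu eps (seg s t).
Let E A : {mpoly F[n]} := raise F A.

Let segT : seg 1 p.+2 = [set: 'I_n].
Proof. by apply/setP => j; rewrite !inE /= -np ltn_ord. Qed.

Let seg12 t : (0 < t)%N -> seg 1 1 :|: seg 2 t = seg 1 t :> {set 'I_n}.
Proof. by move=> t0; apply/setP => j; rewrite !inE; lia. Qed.

Let disjoint12 t : [disjoint (seg 1 1 : {set 'I_n}) & seg 2 t].
Proof. exact: seg_disjoint. Qed.

(** beta_(m-1) + 1 is the lowest weight of y^eps for [m]; this matches the Casimir
    eigenvalues with kappa ([kappaE]). *)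
Lemma vacuum_weight_beta i : (i < n)%N -> nu 1 i.+1 = beta mu eps i + 1.
Proof.
move=> i_n; rewrite /nu /vacuum_weight /beta.
rewrite (eq_bigl (fun j : 'I_n => (j < i.+1)%N)); last by move=> j; rewrite inE.
rewrite !big_split /= -(big_ord_widen n (fun=> 2^-1 : F)) // sumr_const card_ord.
by rewrite -[_ *+ _]mulr_natl; ring.
Qed.

(** x_1, ..., x_(n-2), completed by x_(n-1) = N. *)
Definition psi_labels (l : 'X_{1..p}) i : nat := if (i < p)%N then psum l i.+1 else N.

Definition psi_vec (l : 'X_{1..p}) : {mpoly F[n]} :=
  chain mu eps 1 (fun i => if i is j.+1 then psi_labels l j else 0%N) p.+1 * vacuum F eps.

Definition phi_vec (k : 'X_{1..p}) : {mpoly F[n]} :=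
  coupling (N - psum k p) (nu 1 1) (nu 2 p.+2 + 2 * (psum k p)%:R)
    (E (seg 1 1)) (E (seg 2 p.+2)) * (chain mu eps 2 (psum k) p * vacuum F eps).

Section Psi.
Variable l : 'X_{1..p}.
Hypothesis lN : (mdeg l <= N)%N.

Lemma psi_labels_le i : (i <= p)%N -> (psi_labels l i <= N)%N.
Proof.
move=> ip; rewrite /psi_labels; case: ltnP => // i_p.
by apply: leq_trans lN; rewrite -psum_mdeg psum_mono.
Qed.

Lemma psi_labels_mono i : (i < p)%N -> (psi_labels l i <= psi_labels l i.+1)%N.
Proof.
move=> ip; rewrite /psi_labels ip; case: ltnP => i1; first by rewrite psum_mono.
by apply: leq_trans lN; rewrite -psum_mdeg psum_mono.
Qed.

Lemma psi_labels_last : psi_labels l p = N.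
Proof. by rewrite /psi_labels ltnn. Qed.

Lemma psi_vec_neq0 : psi_vec l != 0.
Proof. by rewrite mulf_neq0 ?chain_neq0 ?vacuum_neq0 //; lia. Qed.

Let x' i := if i is j.+1 then psi_labels l j else 0%N.
Let x'_mono i : (i < p.+1)%N -> (x' i <= x' i.+1)%N.
Proof. by case: i => //= i ip; apply: psi_labels_mono. Qed.

Lemma psi_vec_harmonic : dunkl_harmonic mu (2 * N + \sum_(j < n) eps j)%N eps (psi_vec l).
Proof.
apply: harmonic_lowest => [|i].
  have := @lowest_chain F n mu eps mu_gt0 1 x' p.+1 isT _ erefl x'_mono.
  by rewrite /= add1n psi_labels_last segT; apply; rewrite np.
by rewrite refl_chain refl_vacuum scalerAr.
Qed.

Lemma casimir_psi_vec m : (2 <= m <= p.+1)%N ->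
  casimir mu (seg 1 m) (psi_vec l) = kappa (psum l m.-1)%:R (beta mu eps m.-1) *: psi_vec l.
Proof.
case: m => [|[|m]] // /andP[_ mp]; have mn : (1 + p.+1 <= n)%N by rewrite np.
have := casimir_chain eps mu_gt0 (s := 1) (m := m.+1) isT (ltnW mp) mn erefl x'_mono.
rewrite /= add1n kappaE -/(nu 1 _) vacuum_weight_beta; last by rewrite np; lia.
by have mp' : (m < p)%N := mp; rewrite addrK /psi_labels mp'.
Qed.

End Psi.

Section Phi.
Variable k : 'X_{1..p}.
Hypothesis kN : (mdeg k <= N)%N.

(** In a chain each factor takes the value 1 at the point where only its first
    variable is nonzero, so the product is nonzero in the integral domain; the
    final coupling takes the value 1 where only y_1 is nonzero. *)
Lemma phi_vec_neq0 : phi_vec k != 0.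
Proof.
have n0 : (0 < n)%N by rewrite np.
rewrite mulf_neq0 //; last by rewrite mulf_neq0 ?chain_neq0 ?vacuum_neq0 //; lia.
by apply: (@coupling_raise_neq0 _ _ _ _ _ _ _ (Ordinal n0)); rewrite inE.
Qed.

Let psum_step i : (i < p)%N -> (psum k i <= psum k i.+1)%N.
Proof. by move=> _; apply: psum_mono. Qed.

Lemma phi_vec_harmonic : dunkl_harmonic mu (2 * N + \sum_(j < n) eps j)%N eps (phi_vec k).
Proof.
apply: harmonic_lowest => [|i]; last by rewrite refl_coupling refl_chain refl_vacuum !scalerAr.
rewrite -segT -(@seg12 p.+2) // vacuum_weightU //.
rewrite [X in lowest _ _ X](_ : _ = nu 1 1 + (nu 2 p.+2 + 2 * (psum k p)%:R)
   + 2 * (N - psum k p)%:R); last by rewrite natrB ?psum_mdeg // /nu; ring.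
have nu2 : 0 < nu 2 p.+2.
  have pn : (2 + p <= n)%N by rewrite np.
  have := vacuum_weight_gt eps mu_gt0 (s := 2) (i := p) isT pn; rewrite add2n.
  by apply: lt_trans; rewrite divr_gt0.
apply: lowest_coupling => //; first by rewrite ltr_wpDr ?mulr_ge0.
  by apply: lowest_chain_out => i ip; apply: seg_disjoint.
by apply: (lowest_chain _ mu_gt0 (s := 2)) => //; rewrite ?np ?psum0.
Qed.

Lemma casimir_phi_vec m : (2 <= m <= p.+1)%N ->
  casimir mu (seg 2 m.+1) (phi_vec k)
  = kappa (psum k m.-1)%:R (beta mu eps m - beta mu eps 0 - 1) *: phi_vec k.
Proof.
case: m => [|m] // /andP[m2 mp]; rewrite (coupling_comm (P := casimir mu (seg 2 m.+2))) /=.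
- have mn : (2 + p <= n)%N by rewrite np.
  rewrite (casimir_chain eps mu_gt0 (s := 2) (m := m) isT _ mn) ?psum0 // kappaE -scalerAr -/(phi_vec k).
  congr (kappa _ (_ - 1) *: _).
  have := vacuum_weightU mu eps (disjoint12 m.+2); rewrite seg12 // -!/(nu _ _).
  by rewrite !vacuum_weight_beta ?np // => E1; apply: (addrI (beta mu eps 0 + 1)); rewrite -E1; ring.
- by move=> g; apply: casimir_raise_disjoint; rewrite disjoint_sym.
- by move=> g; apply: casimir_raise_sub; apply/subsetP => j; rewrite !inE; lia.
Qed.

End Phi.

Definition phi_gauge (k : 'X_{1..p}) : F := \prod_(i < p) hybrid_gauge mu eps i (psum k i) (k i).

Lemma phi_gauge_neq0 k : phi_gauge k != 0.
Proof.
apply/prodf_neq0 => i _; rewrite /hybrid_gauge /recoupling_gauge; have ip := ltn_ord i.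
have half0 (j : nat) : 0 <= j%:R / 2 :> F by rewrite divr_ge0.
have nuB : i.+1%:R / 2 < nu 2 i.+2 by apply: (@vacuum_weight_gt _ _ _ _ mu_gt0 2 i); lia.
have nuj : 1%:R / 2 < nu i.+3 i.+3.
  have := vacuum_weight_gt eps mu_gt0 (s := i.+3) (i := 0%N); rewrite addn0; apply=> //; lia.
have nuB0 : 0 < nu 2 i.+2 + 2 * (psum k i)%:R.
  by rewrite ltr_wpDr ?mulr_ge0 // (le_lt_trans _ nuB).
have sg : 0 < nu 2 i.+2 + 2 * (psum k i)%:R + nu i.+3 i.+3 - 1.
  rewrite subr_gt0 addrAC ltr_wpDr ?mulr_ge0 // (_ : 1 = 1%:R / 2 + 1%:R / 2 :> F); last by field.
  by apply: ltrD => //; apply: le_lt_trans nuB; rewrite ler_pM2r ?invr_gt0 // ler_nat.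
rewrite mulf_neq0 ?signr_eq0 // invr_eq0 !mulf_neq0 ?fact_neq0 ?poch_neq0 //.
by rewrite addrAC ltr_wpDr.
Qed.

Lemma nth_psi_labels l i : (i <= p)%N ->
  nth N%:R [tuple (psum l i.+1)%:R | i < p] i = (psi_labels l i)%:R :> F.
Proof.
rewrite /psi_labels; case: ltnP => [ip _|pi _]; last by rewrite nth_default ?size_tuple.
by rewrite -(tnth_nth _ _ (Ordinal ip)) tnth_mktuple.
Qed.

Lemma vacuum_weight_beta_diff j : (j.+1 < n)%N ->
  nu 2 j.+2 = beta mu eps j.+1 - beta mu eps 0.
Proof.
move=> jn; have := vacuum_weightU mu eps (disjoint12 j.+2); rewrite seg12 // -!/(nu _ _).
rewrite !vacuum_weight_beta //; last by lia.
by move=> e; apply: (addrI (beta mu eps 0 + 1)); rewrite -e; ring.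
Qed.

Lemma multi_racahE (k l : 'X_{1..p}) :
  multi_racah k [tuple (psum l i.+1)%:R | i < p] (beta mu eps) N%:R =
  \prod_(i < p) hybrid_racah mu eps (psi_labels l) i (psum k i) (k i).
Proof.
apply: eq_bigr => i _; rewrite !nth_psi_labels //; last by rewrite ltnW.
move: (psum k i) (k i) (ltn_ord i) => K m; move: (nat_of_ord i) => j jp.
rewrite /hybrid_racah -!/(nu _ _).
have E1 : nu 2 j.+2 = beta mu eps j.+1 - beta mu eps 0.
  by rewrite vacuum_weight_beta_diff //; lia.
have E3 : nu j.+3 j.+3 = beta mu eps j.+2 - beta mu eps j.+1.
  have dj : [disjoint (seg 1 j.+2 : {set 'I_n}) & seg j.+3 j.+3] by apply: seg_disjoint.
  have := vacuum_weightU mu eps dj; have := segS n 1 j.+1; rewrite add1n => <-; rewrite -!/(nu _ _).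
  rewrite !vacuum_weight_beta; [move=> e | rewrite np; lia | rewrite np; lia].
  by apply: (addrI (beta mu eps j.+1 + 1)); rewrite -e; ring.
have E0 : nu 1 1 = beta mu eps 0 + 1 by rewrite vacuum_weight_beta // np.
rewrite E0 E1 E3; move: (beta mu eps j.+2) (beta mu eps j.+1) (beta mu eps 0) => b2 b1 b0.
move: (psi_labels l j.+1)%:R (psi_labels l j)%:R K%:R => x1 x0 q.
have -> : b1 - b0 + 2 * q - 1 = 2 * q + b1 - b0 - 1 by ring.
by have -> : b0 + 1 + (b1 - b0) + q - 1 + x1 = q + b1 + x1 by ring.
Qed.

(** The expansion of the joint eigenvectors, obtained by n-2 recouplings; sequences
    of total degree > N contribute 0 by [path_coef_eq0]. *)
Lemma psi_vec_expansion (l : 'X_{1..p}) : (mdeg l <= N)%N -> psi_vec l =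
  \sum_(k : 'X_{1..p < N.+1}) (phi_gauge k *
     multi_racah k [tuple (psum l i.+1)%:R | i < p] (beta mu eps) N%:R) *: phi_vec k.
Proof.
move=> lN.
have pn : (p.+2 <= n)%N by rewrite np.
have -> : psi_vec l = hybrid mu eps p (psi_labels l) 0 0 * vacuum F eps.
  congr (_ * _); rewrite /chain big_ord_recl /hybrid big_mkord; congr (_ * _).
  by rewrite /chain_factor /= subn0 !mulr0 !addr0.
have l2 : lowest mu (seg 2 2) (nu 2 2 + 2 * 0%:R) (vacuum F eps).
  by rewrite mulr0 addr0; apply: lowest_vacuum.
rewrite (hybrid_paths mu_gt0 pn (psi_labels_last l) (psi_labels_le lN)
   (psi_labels_mono lN) (add0n p) (leq0n _) (lowest_vacuum mu eps (seg 1 1)) l2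
   (fun h _ => lowest_vacuum mu eps (seg h.+3 h.+3))).
rewrite (big_tuple_bmultinom (G := fun s => path_coef mu eps (psi_labels l) 0 0 s *:
   (hybrid mu eps p (psi_labels l) p (0 + sumn s) *
    (path_poly mu eps 0 0 s * vacuum F eps)))); last first.
  move=> s sp sN; rewrite (path_coef_eq0 mu eps pn (psi_labels_last l)) ?scale0r //.
  - by move=> i; apply: psi_labels_mono.
  - by rewrite sp.
  - by rewrite sp !add0n psi_labels_last.
apply: eq_bigr => k _; rewrite path_coefE path_polyE size_tuple add0n.
have Ek : sumn (bmnm k) = psum k p by rewrite psum_mdeg /mdeg sumnE.
congr (_ * _ *: _).
- by apply: eq_bigr => i _; rewrite psumE [k i](tnth_nth 0%N).
- rewrite multi_racahE; apply: eq_bigr => i _; by rewrite psumE [k i](tnth_nth 0%N).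
rewrite /phi_vec /hybrid psi_labels_last Ek big_geq // mulr1.
congr (_ * (_ * _)); apply: eq_bigr => i _.
by rewrite /chain_factor !psumE.
Qed.

End JointEigenbases.

Theorem theorem4p3
  (F : numFieldType) (n : nat) (n_ge3 : (3 <= n)%N)
  (mu : 'I_n -> F) (mu_gt0 : forall j, 0 < mu j)
  (a : nat) (eps : 'I_n -> bool)
  (H_neq0 : exists2 f, dunkl_harmonic mu a eps f & f != 0)
  (psi phi : 'X_{1..n.-2 < (racah_size a eps).+1} -> {mpoly F[n]})
  (psi_basis : is_basis (dunkl_harmonic mu a eps) psi)
  (phi_basis : is_basis (dunkl_harmonic mu a eps) phi)
  (psi_diag : diagonalized_by
     (gen_alg (fun X => exists2 t, (2 <= t <= n.-1)%N & X = casimir mu (seg 1 t)))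
     psi)
  (phi_diag : diagonalized_by
     (gen_alg (fun X => exists2 t, (3 <= t <= n)%N & X = casimir mu (seg 2 t)))
     phi)
  (psi_label : forall l m, (2 <= m <= n.-1)%N ->
     casimir mu (seg 1 m) (psi l)
     = kappa (psum l m.-1)%:R (beta mu eps m.-1) *: psi l)
  (phi_label : forall k m, (2 <= m <= n.-1)%N ->
     casimir mu (seg 2 m.+1) (phi k)
     = kappa (psum k m.-1)%:R (beta mu eps m - beta mu eps 0 - 1) *: phi k)
  (R : 'X_{1..n.-2 < (racah_size a eps).+1} ->
       'X_{1..n.-2 < (racah_size a eps).+1} -> F)
  (R_connection : forall l, psi l = \sum_k R k l *: phi k) :
  exists g h : 'X_{1..n.-2 < (racah_size a eps).+1} -> F,
    [/\ forall l, g l != 0,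
        forall k, h k != 0
      & forall k l,
          R k l = g l * h k *
            multi_racah k [tuple (psum l i.+1)%:R | i < n.-2]
              (beta mu eps) (racah_size a eps)%:R].
Proof.
have np : n = n.-2.+2 by lia.
have n1 : n.-1 = n.-2.+1 by lia.
have aE : a = (2 * racah_size a eps + \sum_(j < n) eps j)%N.
  by have [f fH f0] := H_neq0; apply: dunkl_harmonic_deg fH f0.
set N := racah_size a eps in psi phi psi_basis phi_basis psi_diag phi_diag
  psi_label phi_label R R_connection aE *.
have bN (k : 'X_{1..n.-2 < N.+1}) : (mdeg (bmnm k) <= N)%N by have := valP k.
have psi_unique (l : 'X_{1..n.-2 < N.+1}) :
    exists c, psi_vec mu eps N (bmnm l) = c *: psi l.
  apply: (eigenvector_unique (op := fun m => casimir mu (seg 1 m))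
    (ev := fun l m => kappa (psum (bmnm l) m.-1)%:R (beta mu eps m.-1))
    (dom := fun m => (2 <= m <= n.-1)%N) psi_basis).
  - by move=> i m mn; apply: psi_label.
  - move=> i j ij; apply: val_inj; apply: psum_inj => m mp.
    have /ij : (2 <= m.+1 <= n.-1)%N by lia.
    apply: kappa_inj => /=; have mn : (1 + m <= n)%N by lia.
    have := vacuum_weight_gt eps mu_gt0 (s := 1) isT mn; rewrite add1n.
    rewrite vacuum_weight_beta //.
    rewrite -ltrBlDr; apply: le_lt_trans; rewrite subr_ge0 ler_pdivlMr // mul1r ler_nat; lia.
  - by rewrite aE; apply: psi_vec_harmonic.
  - by move=> m mn; rewrite /= casimir_psi_vec // -n1.
have phi_unique (k : 'X_{1..n.-2 < N.+1}) :
    exists c, phi_vec mu eps N (bmnm k) = c *: phi k.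
  apply: (eigenvector_unique (op := fun m => casimir mu (seg 2 m.+1))
    (ev := fun k m => kappa (psum (bmnm k) m.-1)%:R (beta mu eps m - beta mu eps 0 - 1))
    (dom := fun m => (2 <= m <= n.-1)%N) phi_basis).
  - by move=> i m mn; apply: phi_label.
  - move=> i j ij; apply: val_inj; apply: psum_inj => m mp.
    have /ij : (2 <= m.+1 <= n.-1)%N by lia.
    apply: kappa_inj => /=; have mn : (2 + m <= n)%N by lia.
    have := vacuum_weight_gt eps mu_gt0 (s := 2) isT mn; rewrite add2n.
    rewrite (vacuum_weight_beta_diff mu eps np) // -subr_gt0 => w.
    have : 0 <= m.+1%:R / 2 - 1 :> F.
      by rewrite subr_ge0 ler_pdivlMr // mul1r ler_nat; lia.
    by move=> m2; have := ltr_wpDr m2 w; rewrite addrA subrK.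
  - by rewrite aE; apply: phi_vec_harmonic.
  - by move=> m mn; rewrite /= casimir_phi_vec // -n1.
have [c cE] := fin_all_exists psi_unique; have [d dE] := fin_all_exists phi_unique.
have c0 l : c l != 0.
  apply: contraNneq (psi_vec_neq0 mu eps np (bN l)) => c0.
  by rewrite cE c0 scale0r.
have d0 k : d k != 0.
  apply: contraNneq (phi_vec_neq0 mu eps np (bN k)) => d0.
  by rewrite dE d0 scale0r.
exists (fun l => (c l)^-1), (fun k => phi_gauge mu eps (bmnm k) * d k).
split=> [l|k|k l]; first by rewrite invr_eq0.
  by apply: mulf_neq0 => //; apply: phi_gauge_neq0.
have [_ phi_free _] := phi_basis.
apply/eqP; rewrite -subr_eq0; apply/eqP.
pose r k := (c l)^-1 * (phi_gauge mu eps (bmnm k) * d k) *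
  multi_racah k [tuple (psum l i.+1)%:R | i < n.-2] (beta mu eps) N%:R.
apply: (phi_free (fun k => R k l - r k)).
have -> : \sum_k (R k l - r k) *: phi k = psi l - \sum_k r k *: phi k.
  by rewrite R_connection -sumrB; apply: eq_bigr => h _; rewrite scalerBl.
have -> : psi l = (c l)^-1 *: psi_vec mu eps N (bmnm l).
  by rewrite cE scalerA mulVf // scale1r.
rewrite (psi_vec_expansion eps mu_gt0 np (bN l)) scaler_sumr -sumrB big1 // => h _.
rewrite dE !scalerA -scalerBl /r.
by rewrite [X in X *: _](_ : _ = 0) ?scale0r //; ring.
Qed.
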